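(* Let $\Sigma$ be a complete spacelike hypersurface with constant mean curvature $H=1$ in the Minkowski spacetime $\mathbb R^{3,1}$, which is the entire graph $t=u(\mathbf x)$, $\mathbf x\in\mathbb R^3$. Suppose that $P(u):=r-u$, as a function of $(\mathbf y,s)$, is smooth up to $s=0$, and that the scalar curvature $\mathcal S$ of $\Sigma$ satisfies $|\mathcal S+6|=O(s^4)$. Then $$u(\mathbf x)=\left(1+|\mathbf x+\mathbf a|^2\right)^{\frac12}+b$$ for some constant vector $\mathbf a\in\mathbb R^3$ and a constant $b$. In particular, $\Sigma$ is isometric to the hyperbolic space $\mathbb H^3$.
   Context: $\mathbb R^{3,1}$ has the metric $-dt^2+|d\mathbf x|^2$ with $\partial_t$ future directed. Write $\mathbf x=r\mathbf y$ with $r=|\mathbf x|$, $\mathbf y\in\mathbb S^2$ (the unit sphere), and $s=r^{-1}$; ''smooth up to $s=0$'' means that the function, defined on $\mathbb S^2\times(0,s_0]$, extends smoothly to $\mathbb S^2\times[0,s_0]$. The mean curvature is one third of the trace of the second fundamental form with respect to the future directed unit normal $\mathbf n$, $H=\frac13\mathrm{div}\,\mathbf n$ (so $t=\sqrt{1+|\mathbf x|^2}$ has $H=1$). $\mathbb H^3$ has constant curvature $-1$. *)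

(* Defs.v *)
From HB Require Import structures.
From mathcomp Require Import all_boot all_order all_algebra.
From mathcomp Require Import all_classical all_reals all_analysis.

Set Implicit Arguments.
Unset Strict Implicit.
Unset Printing Implicit Defensive.

Import Order.TTheory GRing.Theory Num.Theory.
Import numFieldNormedType.Exports.

Local Open Scope classical_set_scope.
Local Open Scope ring_scope.

(** Class C^k on an open set [U], by iterated directional derivatives; in
    finite dimension this is the usual notion. Since [U] is open, the values
    of [f] outside [U] are irrelevant. *)
Fixpoint class_C {R : realType} {V W : normedModType R} (U : set V) (k : nat)
    (f : V -> W) : Prop :=
  (forall x, U x -> {for x, continuous f}) /\
  match k with
  | 0 => True
  | k'.+1 =>
      forall v : V, (forall x, U x -> derivable f x v) /\ class_C U k' ('D_v f)
  end.

Definition smooth {R : realType} {V W : normedModType R} (U : set V)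
    (f : V -> W) : Prop :=
  forall k, class_C U k f.

(** Smoothness on an arbitrary, not necessarily open, subset of a vector
    space: local existence of smooth extensions. For a submanifold with
    boundary such as [S^2 x [0, s0]] in R^3 x R, this is smoothness up to the
    boundary. *)
Definition smooth_on {R : realType} {V W : normedModType R} (A : set V)
    (f : V -> W) : Prop :=
  forall p, A p -> exists (U : set V) (F : V -> W),
    [/\ open U, U p, smooth U F & forall q, (A `&` U) q -> F q = f q].

Definition extends_smoothly {R : realType} {V W : normedModType R}
    (A B : set V) (f : V -> W) : Prop :=
  exists F : V -> W, smooth_on B F /\ forall p, A p -> F p = f p.

(** The library norm [`|x|] on row vectors is the sup norm. *)
Definition enorm {R : realType} {n : nat} (x : 'rV[R]_n) : R :=
  Num.sqrt (\sum_i x 0 i ^+ 2).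

Definition unit_sphere {R : realType} {n : nat} : set 'rV[R]_n :=
  [set y | enorm y = 1].

Definition unit_ball {R : realType} {n : nat} : set 'rV[R]_n :=
  [set y | enorm y < 1].

Definition basis_vec {R : realType} {n : nat} (i : 'I_n) : 'rV[R]_n :=
  delta_mx 0 i.

Definition partial {R : realType} {n : nat} {W : normedModType R} (i : 'I_n)
    (f : 'rV[R]_n -> W) : 'rV[R]_n -> W :=
  'D_(basis_vec i) f.

(** A metric on an open subset of R^n is given by its Gram matrix
    [g x i j = g(d_i, d_j)] at [x]. *)
Definition christoffel {R : realType} {n : nat} (g : 'rV[R]_n -> 'M[R]_n)
    (k i j : 'I_n) (x : 'rV[R]_n) : R :=
  2^-1 * \sum_l invmx (g x) k l *
    (partial i (fun z => g z j l) x + partial j (fun z => g z i l) x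
     - partial l (fun z => g z i j) x).

(** Sign convention: the Ricci curvature of the round sphere is positive. *)
Definition ricci {R : realType} {n : nat} (g : 'rV[R]_n -> 'M[R]_n)
    (i j : 'I_n) (x : 'rV[R]_n) : R :=
  \sum_k (partial k (christoffel g k i j) x - partial j (christoffel g k i k) x)
  + \sum_k \sum_l (christoffel g k k l x * christoffel g l i j x
                   - christoffel g k j l x * christoffel g l i k x).

Definition scalar_curvature {R : realType} {n : nat} (g : 'rV[R]_n -> 'M[R]_n)
    (x : 'rV[R]_n) : R :=
  \sum_i \sum_j invmx (g x) i j * ricci g i j x.

Definition is_geodesic {R : realType} {n : nat} (g : 'rV[R]_n -> 'M[R]_n)
    (c : R -> 'rV[R]_n) : Prop :=
  forall t : R,
    [/\ derivable c t 1, derivable (derive1 c) t 1 &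
        forall k : 'I_n,
          derive1 (derive1 c) t 0 k
          + \sum_i \sum_j christoffel g k i j (c t)
                          * derive1 c t 0 i * derive1 c t 0 j = 0].

(** Geodesic completeness of R^n with the metric [g]. *)
Definition complete_metric {R : realType} {n : nat}
    (g : 'rV[R]_n -> 'M[R]_n) : Prop :=
  forall p v : 'rV[R]_n, exists c : R -> 'rV[R]_n,
    [/\ is_geodesic g c, c 0 = p & derive1 c 0 = v].

Definition metric_at {R : realType} {n : nat} (G : 'M[R]_n) (v w : 'rV[R]_n)
    : R :=
  (v *m G *m w^T) 0 0.

(** [phi] is a diffeomorphism of [U] onto [V] with inverse [psi], and
    [phi^* h = g]. *)
Definition isometric {R : realType} {n : nat}
    (U : set 'rV[R]_n) (g : 'rV[R]_n -> 'M[R]_n)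
    (V : set 'rV[R]_n) (h : 'rV[R]_n -> 'M[R]_n) : Prop :=
  exists phi psi : 'rV[R]_n -> 'rV[R]_n,
    [/\ smooth U phi /\ smooth V psi,
        (forall x, U x -> V (phi x) /\ psi (phi x) = x),
        (forall y, V y -> U (psi y) /\ phi (psi y) = y) &
        forall x v w, U x ->
          metric_at (h (phi x)) ('D_v phi x) ('D_w phi x)
          = metric_at (g x) v w].

(** Poincare ball model of hyperbolic space, of constant curvature -1. *)
Definition hyperbolic_metric {R : realType} {n : nat} (y : 'rV[R]_n)
    : 'M[R]_n :=
  (4 / (1 - enorm y ^+ 2) ^+ 2)%:M.

(** Points and vectors of R^{3,1} are pairs (x, t). *)
Definition minkowski {R : realType} (X Y : 'rV[R]_3 * R) : R :=
  (\sum_i X.1 0 i * Y.1 0 i) - X.2 * Y.2.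

Definition graph {R : realType} (u : 'rV[R]_3 -> R) (x : 'rV[R]_3)
    : 'rV[R]_3 * R :=
  (x, u x).

Definition induced_metric {R : realType} (u : 'rV[R]_3 -> R) (x : 'rV[R]_3)
    : 'M[R]_3 :=
  \matrix_(i, j) minkowski (partial i (graph u) x) (partial j (graph u) x).

Definition spacelike {R : realType} (u : 'rV[R]_3 -> R) : Prop :=
  forall x v : 'rV[R]_3, v != 0 -> 0 < metric_at (induced_metric u x) v v.

Definition gradient {R : realType} (u : 'rV[R]_3 -> R) (x : 'rV[R]_3)
    : 'rV[R]_3 :=
  \row_i partial i u x.

(** Future directed; the square root is meaningful since [|Du| < 1] for a
    spacelike graph. *)
Definition unit_normal {R : realType} (u : 'rV[R]_3 -> R) (x : 'rV[R]_3)
    : 'rV[R]_3 * R :=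
  let w := (Num.sqrt (1 - enorm (gradient u x) ^+ 2))^-1 in
  (w *: gradient u x, w).

(** [h(X, Y) = <D_X n, Y>], the sign for which the trace of [h] is [div n]. *)
Definition second_fundamental_form {R : realType} (u : 'rV[R]_3 -> R)
    (x : 'rV[R]_3) : 'M[R]_3 :=
  \matrix_(i, j) minkowski (partial i (unit_normal u) x) (partial j (graph u) x).

Definition mean_curvature {R : realType} (u : 'rV[R]_3 -> R) (x : 'rV[R]_3)
    : R :=
  3^-1 * \tr (invmx (induced_metric u x) *m second_fundamental_form u x).

Definition P {R : realType} (u : 'rV[R]_3 -> R) (x : 'rV[R]_3) : R :=
  enorm x - u x.

(** A function of [x] in the coordinates [(y, s)], where [x = s^-1 y]. *)
Definition at_infinity {R : realType} (f : 'rV[R]_3 -> R) (q : 'rV[R]_3 * R)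
    : R :=
  f (q.2^-1 *: q.1).

Definition smooth_up_to_infinity {R : realType} (f : 'rV[R]_3 -> R) : Prop :=
  exists2 s0 : R, 0 < s0 &
    extends_smoothly (unit_sphere `*` `]0, s0]%classic)
      (unit_sphere `*` `[0, s0]%classic)
      (at_infinity f).

(** [f = O(s^m)] as [s -> 0], uniformly in [y]. *)
Definition bigO_s {R : realType} (f : 'rV[R]_3 -> R) (m : nat) : Prop :=
  exists C s1 : R, 0 < s1 /\
    forall y s, unit_sphere y -> 0 < s <= s1 ->
      `|at_infinity f (y, s)| <= C * s ^+ m.

(* Main.v *)
From HB Require Import structures.
Require Import Defs.
From mathcomp Require Import all_boot all_order all_algebra.
From mathcomp Require Import all_classical all_reals all_analysis.
From mathcomp Require Import ring lra.
Set Implicit Arguments.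
Unset Strict Implicit.
Unset Printing Implicit Defensive.

Import Order.TTheory GRing.Theory Num.Theory.
Import numFieldNormedType.Exports.
Local Open Scope classical_set_scope.
Local Open Scope ring_scope.

(** Write [p = Du], [W = 1 - |p|^2] and [A = W^(-1/2) D^2 u - I + p p^T] for the
    trace-free second fundamental form of the graph. Since the mean curvature
    is 1, the Gauss equation says that the scalar curvature plus 6 is the squared
    norm of [A] ([frobenius_le_scalar]). So the decay hypothesis means that
    [A = O(s^2)].

    Near infinity [u = |x| - F(y, s)] with [F] smooth up to [s = 0]. Let [e] and
    [e'] be tangent to the sphere at [y], with equal lengths. Then
    [W^(-1/2) (D^2 u(e, e) - D^2 u(e', e'))] differs from [A(e, e) - A(e', e')]
    by terms of order [s^2], while
    [D^2 u(e, e) - D^2 u(e', e') = - s^2 (F_ee - F_e'e')(y, s)]. The radial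
    derivative of [u] gives [W = O(s^2)], so that [F_ee - F_e'e' = O(s)]
    ([umbilic_at_infinity]): the spherical Hessian of the limit [F(., 0)] has no
    trace-free part.

    In a stereographic chart, after division by the conformal factor, such a
    function satisfies [g_ab = 0] and [g_aa = g_bb], so it is a quadratic
    polynomial with leading part a multiple of [a^2 + b^2]. Back on the sphere it
    is the restriction of an affine function ([umbilic_affine]). Hence
    [|x| - u] is asymptotic to [A.y + B], uniformly in the direction
    ([asymptotic_affine]).

    The graphs [sqrt (l^2 + |x - A|^2) - B] have the same asymptotics for every
    radius [l], and mean curvature [1 / l]. If [l > 1], a positive
    maximum of the difference of [u] with such a graph would be attained, and at
    that point the Hessians would force [1 <= 1 / l] ([touching_radius]); so [u]
    lies below. For [l < 1] it lies above by the same argument. Letting [l] tend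
    to 1 determines [u] ([hyperboloid_unique]). The isometry with the ball model is
    stereographic projection ([isometry_to_ball]). *)

(** * Directional derivatives *)

Section Calculus.
Context {R : realType}.
Implicit Types (V W : normedModType R).

Lemma continuous_forP V W (f : V -> W) (x : V) :
  {for x, continuous f} <->
  forall e : R, 0 < e ->
    exists2 d : R, 0 < d & forall z, `|z - x| < d -> `|f z - f x| < e.
Proof.
split=> [cf e e0|cf].
  have /cvgrPdistC_lt/(_ _ e0)/nbhs_normP[d /= d0 dP] := cf.
  by exists d => // z zx; apply: dP; rewrite /= distrC.
apply/cvgrPdistC_lt => e /cf[d d0 dP].
by apply/nbhs_normP; exists d => // z /=; rewrite distrC; apply: dP.
Qed.

Lemma open_normP V (U : set V) (x : V) : open U -> U x ->
  exists2 d : R, 0 < d & forall z, `|z - x| < d -> U z.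
Proof.
move=> oU Ux; have /nbhs_normP[d /= d0 dP] := open_nbhs_nbhs (conj oU Ux).
by exists d => // z zx; apply: dP; rewrite /= distrC.
Qed.

Lemma is_derive_line V W (f : V -> W) (z v : V) (t : R) :
  derivable f (z + t *: v) v ->
  is_derive t 1 (fun s : R => f (z + s *: v)) ('D_v f (z + t *: v)).
Proof.
have E : (fun h : R => h^-1 *: (f (z + (h *: 1 + t) *: v) - f (z + t *: v)))
  = (fun h : R => h^-1 *: (f (h *: v + (z + t *: v)) - f (z + t *: v))).
  apply/funext => h; congr (_ *: (f _ - _)).
  by rewrite [h *: 1]mulr1 scalerDl addrCA.
by move=> df; split; rewrite /derivable /derive /= E.
Qed.

Lemma is_derive_affine V W (f : V -> W) (z v : V) (t : R) df :
  is_derive t 1 (fun s : R => f (z + s *: v)) df ->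
  is_derive (z + t *: v) v f df.
Proof.
have E : (fun h : R => h^-1 *: (f (z + (h *: 1 + t) *: v) - f (z + t *: v)))
  = (fun h : R => h^-1 *: (f (h *: v + (z + t *: v)) - f (z + t *: v))).
  apply/funext => h; congr (_ *: (f _ - _)).
  by rewrite [h *: 1]mulr1 scalerDl addrCA.
by case; rewrite /derivable /derive /= E => ? <-; split.
Qed.

(** [h] may be negative: the frame coordinates fed to it below have no sign. *)
Lemma MVT_line V (f : V -> R) (z v : V) (h : R) :
  (forall t : R, `|t| <= `|h| -> derivable f (z + t *: v) v) ->
  exists2 t : R, `|t| <= `|h| &
    f (z + h *: v) - f z = h * 'D_v f (z + t *: v).
Proof.
move=> df.
pose g := fun s : R => f (z + s *: v).
have dg (t : R) : `|t| <= `|h| -> is_derive t 1 g ('D_v f (z + t *: v)).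
  by move=> th; apply: is_derive_line; apply: df.
have cg a b : (forall t, t \in `[a, b] -> `|t| <= `|h|) ->
    {within `[a, b], continuous g}.
  move=> ab; apply: derivable_within_continuous => t tab.
  by have [] := dg t (ab t tab).
have [h0|h0] := leP 0 h.
  have H t : t \in `[0, h] -> `|t| <= `|h|.
    by rewrite in_itv/= => /andP[t0 th]; rewrite !ger0_norm.
  have [|t tI E] := @MVT_segment _ g (fun t => 'D_v f (z + t *: v)) 0 h h0 _
      (cg _ _ H).
    by move=> t /subset_itv_oo_cc /H; apply: dg.
  by exists t; [exact: H|move: E; rewrite /g scale0r addr0 subr0 mulrC].
have H t : t \in `[h, 0] -> `|t| <= `|h|.
  by rewrite in_itv/= => /andP[t0 th]; rewrite !ler0_norm ?lerN2 // ltW.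
have [|t tI E] := @MVT_segment _ g (fun t => 'D_v f (z + t *: v)) h 0 (ltW h0) _
    (cg _ _ H).
  by move=> t /subset_itv_oo_cc /H; apply: dg.
exists t; first exact: H.
by move: E; rewrite /g scale0r addr0 sub0r mulrN mulrC => E;
   rewrite -[RHS]opprK -E opprB.
Qed.

(** Telescope the increment along the frame vectors and apply the mean value
    theorem to each term. The base point [z] is allowed to vary near [x]
    because the induction moves it. *)
Lemma strict_increment V (f : V -> R) (U : set V) (x : V) (I : Type)
    (r : seq I) (b : I -> V) :
  open U -> U x ->
  (forall i z, U z -> derivable f z (b i)) ->
  (forall i, {for x, continuous ('D_(b i) f)}) ->
  forall e : R, 0 < e -> exists2 d : R, 0 < d &
    forall z (h : I -> R), `|z - x| < d -> (forall i, `|h i| < d) ->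
    `|f (z + \sum_(i <- r) h i *: b i) - f z
      - \sum_(i <- r) h i * 'D_(b i) f x| <= e * \sum_(i <- r) `|h i|.
Proof.
move=> oU Ux df cf e e0; elim: r => [|i r [d1 d10 IH]].
  by exists 1 => // z h _ _; rewrite !big_nil addr0 subr0 subrr normr0 mulr0.
have [d2 d20 H2] := open_normP oU Ux.
have [d3 d30 H3] := (continuous_forP _ _).1 (cf i) e e0.
pose m := Num.min d1 (Num.min d2 d3).
have m0 : 0 < m by rewrite !lt_min d10 d20 d30.
(* [2 * k * d = m] leaves room for one more step along [b i] *)
pose k := 1 + `|b i|.
have k0 : 0 < k by rewrite ltr_pwDl.
have k1 : 1 <= k by rewrite lerDl.
pose d := m / (2 * k).
have d0 : 0 < d by rewrite divr_gt0 // mulr_gt0.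
have dm : d * (2 * k) = m by rewrite divfK // gt_eqF // mulr_gt0.
exists d => // z h zx hd.
have small (t : R) : `|t| <= `|h i| -> `|z + t *: b i - x| < m.
  move=> th; rewrite addrAC (le_lt_trans (ler_normD _ _)) // normrZ.
  have A : `|t| * `|b i| <= d * `|b i|.
    by rewrite ler_wpM2r // (le_trans th) // ltW.
  rewrite (@lt_le_trans _ _ (d + d * `|b i|)) ?ltr_leD // -dm mulrCA.
  have B : d <= d * k by rewrite ler_peMr // ltW.
  by rewrite -[X in X + _]mulr1 -mulrDr -/k; lra.
have small2 (t : R) : `|t| <= `|h i| -> U (z + t *: b i).
  by move=> /small; rewrite !lt_min => /and3P[_ ? _]; apply: H2.
have small3 (t : R) : `|t| <= `|h i| ->
    `|'D_(b i) f (z + t *: b i) - 'D_(b i) f x| < e.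
  by move=> /small; rewrite !lt_min => /and3P[_ _ ?]; apply: H3.
have dm1 : d <= d1.
  have A : m <= d1 by rewrite ge_min lexx.
  rewrite (le_trans _ A) // -dm ler_peMr ?ltW //; lra.
rewrite !big_cons addrA.
have {}IH : `|f (z + h i *: b i + \sum_(j <- r) h j *: b j)
    - f (z + h i *: b i) - \sum_(j <- r) h j * 'D_(b j) f x|
    <= e * \sum_(j <- r) `|h j|.
  apply: IH => [|j]; last by rewrite (lt_le_trans (hd j)).
  by have := small _ (lexx _); rewrite !lt_min => /and3P[].
have [t th E] := @MVT_line _ f z (b i) (h i) (fun t ht => df i _ (small2 t ht)).
rewrite (_ : _ - _ = (f (z + h i *: b i + \sum_(j <- r) h j *: b j)
    - f (z + h i *: b i) - \sum_(j <- r) h j * 'D_(b j) f x) +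
   (f (z + h i *: b i) - f z - h i * 'D_(b i) f x)); last by ring.
rewrite (le_trans (ler_normD _ _)) // mulrDr addrC lerD //.
rewrite E -mulrBr normrM mulrC ler_wpM2r // ltW //.
exact: small3.
Qed.

(** Finite-dimensionality, in the form of a finite frame with uniformly
    bounded coordinates. *)
Definition finite_frame V := exists (I : Type) (r : seq I) (b : I -> V)
  (c : I -> {linear V -> R}) (k : R),
  (forall i v, `|c i v| <= k * `|v|) /\
  forall v, v = \sum_(i <- r) c i v *: b i.

Lemma coord_le_norm n (v : 'rV[R]_n) i : `|v 0 i| <= `|v|.
Proof.
rewrite [leRHS]/Num.Def.normr/= mx_normrE.
exact: (le_bigmax _ (fun ij : 'I_1 * 'I_n => `|v ij.1 ij.2|) (0, i)).
Qed.

Lemma finite_frame_rV n : finite_frame 'rV[R]_n.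
Proof.
have lin (i : 'I_n) : linear (fun v : 'rV[R]_n => v 0 i : R).
  by move=> a u v; rewrite !mxE.
pose L i := GRing.isLinear.Build _ _ _ _ _ (lin i).
pose c i : {linear 'rV[R]_n -> R} := HB.pack (fun v : 'rV[R]_n => v 0 i : R) (L i).
exists 'I_n, (index_enum _), (fun i => delta_mx 0 i), c, 1; split.
  by move=> i v; rewrite mul1r; apply: coord_le_norm.
by move=> v; rewrite [LHS]row_sum_delta.
Qed.

Lemma finite_frame_scalar : finite_frame R.
Proof.
exists unit, [:: tt], (fun=> 1), (fun=> idfun), 1; split.
  by move=> _ x; rewrite mul1r.
by move=> v; rewrite big_seq1 /= [_ *: _]mulr1.
Qed.

Lemma finite_frame_prod V W :
  finite_frame V -> finite_frame W -> finite_frame (V * W)%type.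
Proof.
move=> [I [r [b [c [m [cm E]]]]]] [J [s [b' [c' [m' [cm' E']]]]]].
pose q (k : I + J) : V * W -> R :=
  match k with inl i => fun p => c i p.1 | inr j => fun p => c' j p.2 end.
have lin k : linear (q k).
  by case: k => k a u v; rewrite /q /= linearP.
pose L k := GRing.isLinear.Build _ _ _ _ _ (lin k).
pose C k : {linear (V * W)%type -> R} := HB.pack (q k) (L k).
exists (I + J)%type, (map inl r ++ map inr s),
  (fun k => match k with inl i => (b i, 0) | inr j => (0, b' j) end), C,
  (`|m| + `|m'|); split.
  have le1 (v : V) (w : W) : `|v| <= `|(v, w)|.
    by rewrite [leRHS]/Num.Def.normr/= le_max lexx.
  have le2 (v : V) (w : W) : `|w| <= `|(v, w)|.
    by rewrite [leRHS]/Num.Def.normr/= le_max lexx orbT.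
  case=> k [x y] /=.
    rewrite (le_trans (cm k x)) // (@le_trans _ _ (`|m| * `|x|)) //.
      by rewrite ler_wpM2r // ler_norm.
    by rewrite ler_pM // lerDl.
  rewrite (le_trans (cm' k y)) // (@le_trans _ _ (`|m'| * `|y|)) //.
    by rewrite ler_wpM2r // ler_norm.
  by rewrite ler_pM // lerDr.
move=> [v w]; rewrite big_cat !big_map /=.
have S1 : \sum_(i <- r) c i v *: (b i, 0 : W) = (v, 0).
  rewrite {2}[v]E; elim/big_rec2: _ => // i x y _ ->.
  by apply: injective_projections; rewrite /= ?scaler0 ?addr0.
have S2 : \sum_(j <- s) c' j w *: (0 : V, b' j) = (0, w).
  rewrite {2}[w]E'; elim/big_rec2: _ => // i x y _ ->.
  by apply: injective_projections; rewrite /= ?scaler0 ?addr0.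
by rewrite S1 S2; apply: injective_projections; rewrite /= ?addr0 ?add0r.
Qed.

(** Class C^1 is expressed by directional derivatives only; the chain rule
    along curves requires an actual differential. *)
Lemma continuous_derive_differentiable V (f : V -> R) (U : set V) (x : V) :
  finite_frame V -> open U -> U x -> class_C U 1 f -> differentiable f x.
Proof.
move=> [I [r [b [c [k0 [ck0 E]]]]]] oU Ux [_ Hf].
pose k := `|k0| + 1.
have k_gt0 : 0 < k by rewrite ltr_wpDl.
have ck i v : `|c i v| <= k * `|v|.
  by rewrite (le_trans (ck0 i v)) // ler_wpM2r // (le_trans (ler_norm _)) // lerDl.
have df i z : U z -> derivable f z (b i) by have [H _] := Hf (b i); apply: H.
have cf i : {for x, continuous ('D_(b i) f)}.
  by have [_ [H _]] := Hf (b i); apply: H.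
pose L v := \sum_(i <- r) c i v * 'D_(b i) f x.
have lin : linear L.
  move=> a u v; rewrite /L scaler_sumr -big_split; apply: eq_bigr => i _.
  by rewrite linearP mulrDl scalerAl.
pose LM := GRing.isLinear.Build _ _ _ _ _ lin.
pose LL : {linear V -> R} := HB.pack L LM.
have sumk v : \sum_(i <- r) `|c i v| <= ((size r)%:R * k) * `|v|.
  elim: (r) => [|i s IH]; first by rewrite big_nil mul0r mul0r.
  by rewrite big_cons /= mulrS mulrDl mul1r mulrDl lerD.
have LLc : continuous LL.
  apply: bounded_linear_continuous.
  pose M := \sum_(i <- r) k * `|'D_(b i) f x|.
  apply/bounded_funP => a; exists (M * a) => v va.
  rewrite /= /L (le_trans (ler_norm_sum _ _ _)) // /M mulr_suml ler_sum // => i _.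
  rewrite normrM mulrAC ler_wpM2r // (le_trans (ck i v)) // ler_wpM2l //.
  exact: ltW.
suff H : f \o shift x = cst (f x) + LL +o_ 0 id.
  by apply/diff_locallyP; rewrite (diff_unique LLc H).
apply/eqaddoP => e e0.
pose K := (size r)%:R * k + 1.
have K0 : 0 < K by rewrite ltr_wpDl // mulr_ge0 // ltW.
have e' : 0 < e / K by rewrite divr_gt0.
have [d d0 dP] := strict_increment r oU Ux df cf e'.
apply/nbhs_normP; exists (d / k); first by rewrite /= divr_gt0.
move=> v /=; rewrite sub0r normrN ltr_pdivlMr // mulrC => vd.
have := dP x (fun i => c i v).
rewrite subrr normr0 -E => /(_ d0 (fun i => le_lt_trans (ck i v) vd)) H.
rewrite [X in `|X|](_ : _ = f (x + v) - f x - L v); last first.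
  rewrite /= !fctE /= opprD addrA.
  by rewrite [v + x]addrC.
rewrite (le_trans H) // (@le_trans _ _ (e / K * (K * `|v|))) //.
  rewrite ler_wpM2l ?(ltW e') // (le_trans (sumk v)) // ler_wpM2r // lerDl //.
by rewrite mulrA divfK // gt_eqF.
Qed.

Lemma derive_sum_dir V (f : V -> R) x (I : Type) (r : seq I) (a : I -> R)
    (b : I -> V) : differentiable f x ->
  'D_(\sum_(i <- r) a i *: b i) f x = \sum_(i <- r) a i * 'D_(b i) f x.
Proof.
move=> df; rewrite deriveE // linear_sum; apply: eq_bigr => i _.
by rewrite linearZ -deriveE.
Qed.

Lemma derive_comp_curve V (f : V -> R) (c : R -> V) (t : R) c' :
  differentiable f (c t) -> is_derive t 1 c c' ->
  is_derive t 1 (f \o c) ('D_c' f (c t)).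
Proof.
move=> df [dc <-]; have dc' : differentiable c t by apply/derivable1_diffP.
have dfc := differentiable_comp dc' df.
split; first exact: diff_derivable.
by rewrite !deriveE // diff_comp.
Qed.

(** The mixed second difference over a parallelogram of side [h] is computed
    by two applications of the mean value theorem, first along [v] and then
    along [w]. *)
Lemma second_increment V (f : V -> R) (U : set V) (x v w : V) :
  open U -> U x -> class_C U 2 f ->
  forall e, 0 < e -> exists2 d : R, 0 < d & forall h, 0 < h < d ->
  `|f (x + h *: v + h *: w) - f (x + h *: v) - (f (x + h *: w) - f x)
     - h * (h * 'D_w ('D_v f) x)| <= h * (h * e).
Proof.
move=> oU Ux [_ Hf] e e0.
have [dv [_ Hv]] := Hf v; have [dvw [cvw _]] := Hv w.
have [d1 d10 H1] := open_normP oU Ux.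
have [d2 d20 H2] := (continuous_forP _ _).1 (cvw x Ux) e e0.
pose m := Num.min d1 d2; have m0 : 0 < m by rewrite lt_min d10.
pose k := 1 + `|v| + `|w|; have k0 : 0 < k by rewrite /k -addrA ltr_pwDl ?addr_ge0.
exists (m / k); first by rewrite divr_gt0.
move=> h /andP[h0]; rewrite ltr_pdivlMr // => hm.
have near (s t : R) : `|s| <= h -> `|t| <= h -> `|x + s *: v + t *: w - x| < m.
  move=> sh th; rewrite -(addrA x) [x + _]addrC addrK (le_lt_trans (ler_normD _ _)) //.
  rewrite !normrZ (le_lt_trans _ hm) // /k !mulrDr mulr1.
  have A : `|s| * `|v| <= h * `|v| by rewrite ler_wpM2r.
  have B : `|t| * `|w| <= h * `|w| by rewrite ler_wpM2r.
  lra.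
have nearU (s t : R) : `|s| <= h -> `|t| <= h -> U (x + s *: v + t *: w).
  by move=> sh th; have := near s t sh th; rewrite lt_min => /andP[? _]; apply: H1.
have habs : `|h| = h by rewrite gtr0_norm.
pose g z := f (z + h *: w) - f z.
have dg (t : R) : `|t| <= `|h| -> is_derive (x + t *: v) v g
    ('D_v f (x + t *: v + h *: w) - 'D_v f (x + t *: v)).
  rewrite habs => th; apply: is_derive_affine; apply: is_deriveB.
  - rewrite (_ : (fun s => _) = (fun s => f (x + h *: w + s *: v))); last first.
      by apply/funext => s; rewrite /= addrAC.
    rewrite -[x + _ + _ *: w]addrAC; apply: is_derive_line.
    by apply: dv; rewrite addrAC; apply: nearU; rewrite ?habs.
  - apply: is_derive_line; apply: dv.
    by have := nearU t 0 th; rewrite scale0r addr0 normr0; apply; apply: ltW.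
have [t th E] := @MVT_line _ g x v h (fun t th => @ex_derive _ _ _ _ _ _ _ (dg t th)).
have [_ gE] := dg t th; rewrite gE in E.
rewrite habs in th.
have [s sh E2] := @MVT_line _ ('D_v f) (x + t *: v) w h
  (fun s sh => dvw _ (nearU t s th (eq_ind _ (fun y => `|s| <= y) sh _ habs))).
rewrite E2 habs in E sh *.
rewrite -[X in X - _]/(f (x + h *: v + h *: w) - f (x + h *: v) - (f (x + h *: w) - f x)).
move: E; rewrite /g => ->.
rewrite -!mulrBr !normrM habs !(ler_pM2l h0).
by rewrite ltW // H2 //; have := near t s th sh; rewrite lt_min => /andP[].
Qed.

Lemma normrM_pos (a b : R) : 0 < a -> `|a * b| = a * `|b|.
Proof. by move=> a0; rewrite normrM gtr0_norm. Qed.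

Lemma normB_le2 (a b c : R) : `|a| <= c -> `|b| <= c -> `|a - b| <= c + c.
Proof. by move=> ac bc; apply: le_trans (ler_normB _ _) (lerD ac bc). Qed.

(** The mixed second difference is symmetric in [v] and [w], so both iterated
    derivatives are its limit after division by [h ^+ 2]. *)
Lemma derive_comm V (f : V -> R) (U : set V) (x v w : V) :
  open U -> U x -> class_C U 2 f -> 'D_w ('D_v f) x = 'D_v ('D_w f) x.
Proof.
move=> oU Ux cf; apply/eqP; rewrite -subr_eq0 -normr_le0; apply/ler_addgt0Pl => e e0.
have e2 : 0 < e / 2 by rewrite divr_gt0.
have [d d0 H] := @second_increment V f U x v w oU Ux cf _ e2.
have [d' d'0 H'] := @second_increment V f U x w v oU Ux cf _ e2.
pose h := Num.min d d' / 2.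
have h0 : 0 < h by rewrite divr_gt0 // lt_min d0.
have hm : h < Num.min d d' by rewrite ltr_pdivrMr // ltr_pMr ?lt_min ?d0 //; lra.
have := hm; rewrite lt_min => /andP[hd hd'].
have := H h; rewrite h0 hd => /(_ isT); have := H' h; rewrite h0 hd' => /(_ isT).
rewrite [x + h *: w + h *: v]addrAC.
set A := f _; set B := f _; set C := f _; set D := f _ => Q1 Q2.
clearbody A B C D; move: Q1 Q2.
move: ('D_w ('D_v f) x) ('D_v ('D_w f) x) => P Q Q1 Q2.
rewrite addr0 -(ler_pM2l h0) -(ler_pM2l h0).
have -> : h * (h * `|P - Q|) =
    `|(A - B - (C - D) - h * (h * Q)) - (A - C - (B - D) - h * (h * P))|.
  rewrite (_ : A - B - (C - D) - _ - _ = h * (h * (P - Q))); last by ring.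
  by rewrite !(normrM_pos _ h0).
have -> : h * (h * e) = h * (h * (e / 2)) + h * (h * (e / 2)) by field.
by apply: normB_le2.
Qed.
End Calculus.

(** * Smooth functions and rules of differentiation *)

Section Smooth.
Context {R : realType}.
Implicit Types (V W : normedModType R).

Lemma smooth_derivable V W (U : set V) (f : V -> W) x v :
  smooth U f -> U x -> derivable f x v.
Proof. by move=> /(_ 1%N) [_ /(_ v)[]] H _; apply: H. Qed.

Lemma smooth_derive V W (U : set V) (f : V -> W) v :
  smooth U f -> smooth U ('D_v f).
Proof. by move=> sf k; have [_ /(_ v)[]] := sf k.+1. Qed.

Lemma smooth_continuous V W (U : set V) (f : V -> W) x :
  smooth U f -> U x -> {for x, continuous f}.
Proof. by move=> /(_ 0%N) [H _]; apply: H. Qed.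

Lemma smooth_differentiable V (U : set V) (f : V -> R) x :
  finite_frame V -> open U -> smooth U f -> U x -> differentiable f x.
Proof.
by move=> fV oU sf Ux; apply: (continuous_derive_differentiable fV oU Ux (sf _)).
Qed.

Lemma smooth_derive_comm V (U : set V) (f : V -> R) x v w :
  open U -> smooth U f -> U x -> 'D_w ('D_v f) x = 'D_v ('D_w f) x.
Proof. by move=> oU sf Ux; apply: (derive_comm _ _ oU Ux (sf _)). Qed.

Lemma derive_pair V W1 W2 (f : V -> W1) (g : V -> W2) x v :
  derivable f x v -> derivable g x v ->
  'D_v (fun z => (f z, g z)) x = ('D_v f x, 'D_v g x).
Proof.
move=> df dg; apply: cvg_lim; first exact: norm_hausdorff.
set F := fun h => h^-1 *: ((f \o shift x) (h *: v) - f x).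
set G := fun h => h^-1 *: ((g \o shift x) (h *: v) - g x).
exact: (@cvg_pair _ _ _ (0^') _ _ _ _ _ F G df dg).
Qed.

(** [is_derive] hidden from type class resolution, so that the rules below are
    applied by unification only. *)
Definition isD V (x v : V) (f : V -> R) (df : R) : Prop := is_derive x v f df.

Section Rules.
Variables (V : normedModType R) (x v : V).
Implicit Types f g : V -> R.

Lemma isD_derivable f df : isD x v f df -> derivable f x v.
Proof. by case. Qed.
Lemma isD_val f df : isD x v f df -> 'D_v f x = df.
Proof. by case. Qed.
Lemma derivable_isD f : derivable f x v -> isD x v f ('D_v f x).
Proof. exact: derivableP. Qed.
Lemma isD_eq f df df' : isD x v f df -> df = df' -> isD x v f df'.
Proof. by move=> ? <-. Qed.
Lemma isD_near f g df : (\near x, f x = g x) -> isD x v f df -> isD x v g df.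
Proof. exact: near_eq_is_derive. Qed.
Lemma isD_add f g df dg : isD x v f df -> isD x v g dg ->
  isD x v (fun y => f y + g y) (df + dg).
Proof. exact: is_deriveD. Qed.
Lemma isD_sub f g df dg : isD x v f df -> isD x v g dg ->
  isD x v (fun y => f y - g y) (df - dg).
Proof. exact: is_deriveB. Qed.
Lemma isD_opp f df : isD x v f df -> isD x v (fun y => - f y) (- df).
Proof. exact: is_deriveN. Qed.
Lemma isD_mul f g df dg : isD x v f df -> isD x v g dg ->
  isD x v (fun y => f y * g y) (f x * dg + g x * df).
Proof. exact: is_deriveM. Qed.
Lemma isD_sqr f df : isD x v f df ->
  isD x v (fun y => f y ^+ 2) (2 * f x * df).
Proof.
move=> H; rewrite (_ : (fun y => _) = (fun y => f y * f y)).
  by apply: isD_eq (isD_mul H H) _; ring.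
by apply/funext => y; rewrite expr2.
Qed.
Lemma isD_cst (c : R) : isD x v (fun=> c) 0.
Proof. exact: is_derive_cst. Qed.
Lemma isD_inv f df : f x != 0 -> isD x v f df ->
  isD x v (fun y => (f y)^-1) (- (f x)^-1 ^+ 2 * df).
Proof.
move=> f0 [d <-]; split; first exact: derivableV.
by rewrite deriveV // -exprVn.
Qed.
Lemma isD_sqrt f df : 0 < f x -> isD x v f df ->
  isD x v (fun y => Num.sqrt (f y)) ((2 * Num.sqrt (f x))^-1 * df).
Proof.
move=> f0 Hf.
have Hx : is_derive (x + 0 *: v) v f df by rewrite scale0r addr0.
have L : is_derive (0 : R) 1 (fun s : R => f (x + s *: v)) df.
  by case: Hx => d <-; exact: is_derive_line.
have f0' : 0 < f (x + 0 *: v) by rewrite scale0r addr0.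
have H := @is_derive1_comp _ Num.sqrt _ 0 _ _ (is_derive1_sqrt f0') L.
rewrite scale0r addr0 in H.
have := @is_derive_affine _ _ _ (fun y => Num.sqrt (f y)) x v 0 _ H.
by rewrite scale0r addr0.
Qed.
Lemma isD_one_sub_sqr3 f g h a b c :
  isD x v f a -> isD x v g b -> isD x v h c ->
  isD x v (fun z => 1 - (f z ^+ 2 + g z ^+ 2 + h z ^+ 2))
    (- 2 * (f x * a + g x * b + h x * c)).
Proof.
move=> fa gb hc; apply: isD_eq.
  apply: isD_sub; first exact: isD_cst.
  by do 2?[apply: isD_add]; apply: isD_sqr; eassumption.
by ring.
Qed.
End Rules.
End Smooth.

(** * Curvature of a spacelike graph *)

Definition o1 : 'I_3 := Ordinal (isT : (1 < 3)%N).
Definition o2 : 'I_3 := Ordinal (isT : (2 < 3)%N).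

Lemma sum3 {R : realType} (F : 'I_3 -> R) :
  \sum_i F i = F ord0 + F o1 + F o2.
Proof.
rewrite !big_ord_recl big_ord0 addr0 addrA.
by congr (F _ + F _ + F _); apply/val_inj.
Qed.

Lemma sum_metric {R : realType} (p v w : 'I_3 -> R) :
  \sum_i \sum_j v i * ((i == j)%:R - p i * p j) * w j =
  \sum_i v i * w i - (\sum_i v i * p i) * (\sum_i w i * p i).
Proof. by rewrite !sum3 /=; ring. Qed.

Lemma sum_delta_l {R : realType} (k : 'I_3) (F : 'I_3 -> R) :
  \sum_l (k == l)%:R * F l = F k.
Proof.
rewrite (bigD1 k) //= eqxx mul1r big1 ?addr0 // => l.
by rewrite eq_sym => /negbTE ->; rewrite mul0r.
Qed.

(** The curvature computation at one point, as identities between the numbers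
    [p i] (first derivatives of the height), [D i j] (its Hessian) and
    [iW], the inverse of [1 - |p|^2]. The inverse metric is [ginv], and [A] is
    the trace-free second fundamental form when [w ^+ 2 = iW]. *)
Section CurvatureAlgebra.
Context {R : realType}.
Variables (p : 'I_3 -> R) (D : 'I_3 -> 'I_3 -> R) (iW : R).
Hypothesis D_sym : forall i j, D i j = D j i.
Hypothesis iW_slack : iW * (1 - \sum_i p i ^+ 2) = 1.

Let b i := \sum_k p k * D i k.
Let beta := \sum_i p i * b i.
Let ginv i j := (i == j)%:R + iW * p i * p j.
Let A i j w := w * D i j - (i == j)%:R + p i * p j.

Lemma christoffel_algebra k i j :
  2^-1 * \sum_l ginv k l *
    (- (D i j * p l + p j * D i l) + - (D j i * p l + p i * D j l)
     - - (D l i * p j + p i * D l j)) = - (p k * D i j * iW).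
Proof.
have -> : \sum_l ginv k l *
    (- (D i j * p l + p j * D i l) + - (D j i * p l + p i * D j l)
     - - (D l i * p j + p i * D l j)) =
    - 2 * D i j * (\sum_l (k == l)%:R * p l + iW * p k * \sum_l p l ^+ 2).
  rewrite mulr_sumr -big_split mulr_sumr; apply: eq_bigr => l _.
  by rewrite /= (D_sym l i) (D_sym l j) (D_sym j i) /ginv; ring.
rewrite sum_delta_l.
have -> : iW * p k * \sum_l p l ^+ 2 = (iW - 1) * p k.
  have := iW_slack; move: (\sum_l _) => n h.
  by rewrite mulrAC; congr (_ * _); lra.
by field.
Qed.

(** The third derivatives [T] of the height enter both derivatives of the
    Christoffel symbols and cancel. *)
Lemma ricci_algebra (T : 'I_3 -> R) i j :
  \sum_k (- ((D k k * D i j + p k * T k) * iW + 2 * p k * D i j * iW ^+ 2 * b k)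
     - - ((D j k * D i k + p k * T k) * iW + 2 * p k * D i k * iW ^+ 2 * b j))
  + \sum_k \sum_l (- (p k * D k l * iW) * - (p l * D i j * iW)
                   - - (p k * D j l * iW) * - (p l * D i k * iW)) =
  iW * (- (\sum_k D k k) * D i j + \sum_k D i k * D j k)
  + iW ^+ 2 * (- beta * D i j + b i * b j).
Proof. by rewrite /beta /b !sum3; ring. Qed.

Lemma scalar_algebra :
  \sum_i \sum_j ginv i j *
   (iW * (- (\sum_k D k k) * D i j + \sum_k D i k * D j k)
    + iW ^+ 2 * (- beta * D i j + b i * b j)) =
  iW * (\sum_i \sum_j D i j ^+ 2 - (\sum_k D k k) ^+ 2)
  + 2 * iW ^+ 2 * (\sum_i b i ^+ 2 - (\sum_k D k k) * beta).
Proof.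
rewrite /ginv /beta /b !sum3 /=.
rewrite (D_sym o1 ord0) (D_sym o2 ord0) (D_sym o2 o1); ring.
Qed.

(** The right-hand side is the trace of the square of [ginv A], that is, the
    squared metric norm of [A]. With [ginv = I + q q^T], [q = w p], it equals
    [|A|^2 + 2 |A q|^2 + (q A q)^2] in Euclidean norms, hence dominates
    [|A|^2]. *)
Lemma frobenius_algebra w : w ^+ 2 = iW ->
  w * (\sum_k D k k + iW * beta) = 3 ->
  \sum_i \sum_j A i j w ^+ 2 <=
  iW * (\sum_i \sum_j D i j ^+ 2 - (\sum_k D k k) ^+ 2)
  + 2 * iW ^+ 2 * (\sum_i b i ^+ 2 - (\sum_k D k k) * beta) + 6.
Proof.
move=> wW H.
pose q i := w * p i.
pose Aq i := \sum_j A i j w * q j.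
pose n := \sum_i p i ^+ 2.
pose b2 := \sum_i b i ^+ 2.
pose d2 := \sum_i \sum_j D i j ^+ 2.
pose t := \sum_k D k k.
have A2 : \sum_i \sum_j A i j w ^+ 2 =
    w ^+ 2 * d2 + 3 + n ^+ 2 - 2 * w * t - 2 * n + 2 * w * beta.
  by rewrite /A /d2 /n /t /beta /b !sum3 /=; ring.
have AqE i : Aq i = w * (w * b i - (1 - n) * p i).
  rewrite /Aq /A /q /b /n mulrBr.
  under eq_bigr do rewrite mulrDl mulrBl.
  rewrite big_split sumrB /= sum_delta_l !sum3; ring.
have Aq2 : \sum_i Aq i ^+ 2 =
    w ^+ 2 * (w ^+ 2 * b2 - 2 * w * (1 - n) * beta + (1 - n) ^+ 2 * n).
  under eq_bigr do rewrite AqE.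
  by rewrite /b2 /beta /n !sum3; ring.
have qAq : \sum_i q i * Aq i = w ^+ 2 * (w * beta - (1 - n) * n).
  under eq_bigr do rewrite AqE.
  by rewrite /q /beta /n !sum3; ring.
have Aq0 : 0 <= \sum_i Aq i ^+ 2 by apply: sumr_ge0 => i _; apply: sqr_ge0.
have qAq0 := sqr_ge0 (\sum_i q i * Aq i).
suff -> : iW * (\sum_i \sum_j D i j ^+ 2 - (\sum_k D k k) ^+ 2)
  + 2 * iW ^+ 2 * (\sum_i b i ^+ 2 - (\sum_k D k k) * beta) + 6
  = \sum_i \sum_j A i j w ^+ 2 + 2 * \sum_i Aq i ^+ 2
    + (\sum_i q i * Aq i) ^+ 2 by lra.
rewrite A2 Aq2 qAq -/d2 -/b2 -/t.
move: H; rewrite -/t -wW => H.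
have W1 : w ^+ 2 * (1 - n) = 1 by rewrite wW.
move: W1 H; clear; move: beta n b2 d2 t => bt n b2 d2 t W1 H.
have -> : w ^+ 2 * d2 + 3 + n ^+ 2 - 2 * w * t - 2 * n + 2 * w * bt +
    2 * (w ^+ 2 * (w ^+ 2 * b2 - 2 * w * (1 - n) * bt + (1 - n) ^+ 2 * n)) +
    (w ^+ 2 * (w * bt - (1 - n) * n)) ^+ 2 =
   w ^+ 2 * d2 + 3 - 2 * w * t + 2 * w ^+ 4 * b2 + (w ^+ 2 * (w * bt)) ^+ 2
   + (n ^+ 2 - 2 * n) + 2 * w * bt * (1 - 2 * (w ^+ 2 * (1 - n)) - (w ^+ 2 * (1 - n)) * n * w ^+ 2)
   + 2 * (w ^+ 2 * (1 - n)) * (1 - n) * n + (w ^+ 2 * (1 - n)) ^+ 2 * n ^+ 2.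
  by ring.
rewrite W1.
(* [w ^+ 2 * (1 - n) = 1] reduces the identity to [H] *)
have nW : n * w ^+ 2 = w ^+ 2 - 1 by lra.
have -> : 1 * n * w ^+ 2 = w ^+ 2 - 1 by rewrite mul1r.
have -> : 6 = 3 - 2 * (w * (t + w ^+ 2 * bt)) + (w * (t + w ^+ 2 * bt)) ^+ 2 by rewrite H; ring.
by ring.
Qed.

End CurvatureAlgebra.

Section Graph.
Context {R : realType}.
Variable u : 'rV[R]_3 -> R.
Hypothesis su : smooth setT u.
Hypothesis sl : spacelike u.

Definition hess (i j : 'I_3) : 'rV[R]_3 -> R := partial i (partial j u).

Lemma smooth_partial i : smooth setT (partial i u).
Proof. exact: smooth_derive. Qed.

Lemma smooth_hess i j : smooth setT (hess i j).
Proof. by do 2 apply: smooth_derive. Qed.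

Lemma isD_partial i x v : isD x v (partial i u) ('D_v (partial i u) x).
Proof. by apply: derivable_isD; apply: smooth_derivable (smooth_partial i) I. Qed.

Lemma isD_hess i j x v : isD x v (hess i j) ('D_v (hess i j) x).
Proof. by apply: derivable_isD; apply: smooth_derivable (smooth_hess i j) I. Qed.

Lemma hess_sym i j x : hess i j x = hess j i x.
Proof. exact: smooth_derive_comm openT su I. Qed.

Lemma third_sym i j k x : partial i (hess j k) x = partial j (hess i k) x.
Proof. exact: smooth_derive_comm openT (smooth_partial k) I. Qed.

Lemma partial_graph i x : partial i (graph u) x = (basis_vec i, partial i u x).
Proof.
have d2 := smooth_differentiable (finite_frame_rV _) openT su (I : setT x).
rewrite /partial /graph deriveE; last exact: differentiable_pair.
rewrite diff_pair //; congr (_, _).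
  by rewrite -(deriveE (f := id)) // derive_id.
by rewrite deriveE.
Qed.

Lemma minkowski_basis (X : 'rV[R]_3 * R) j t :
  Defs.minkowski X (basis_vec j, t) = X.1 0 j - X.2 * t.
Proof.
rewrite /Defs.minkowski /=; congr (_ - _); rewrite (bigD1 j) //= mxE !eqxx mulr1.
by rewrite big1 ?addr0 // => i /negbTE ij; rewrite mxE ij andbF mulr0.
Qed.

Lemma induced_metricE x i j :
  induced_metric u x i j = (i == j)%:R - partial i u x * partial j u x.
Proof.
by rewrite mxE !partial_graph minkowski_basis /= /basis_vec mxE eqxx eq_sym.
Qed.

Definition grad2 x := \sum_i partial i u x ^+ 2.

Lemma enorm_gradient x : enorm (gradient u x) ^+ 2 = grad2 x.
Proof.
rewrite /enorm sqr_sqrtr; last by apply: sumr_ge0 => i _; apply: sqr_ge0.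
by apply: eq_bigr => i _; rewrite mxE.
Qed.

Lemma metric_atE (G : 'M[R]_3) v w :
  metric_at G v w = \sum_i \sum_j v 0 i * G i j * w 0 j.
Proof.
rewrite /metric_at mxE exchange_big; apply: eq_bigr => j _.
by rewrite !mxE mulr_suml.
Qed.

Lemma induced_metric_at x v w : metric_at (induced_metric u x) v w =
  \sum_i v 0 i * w 0 i - (\sum_i v 0 i * partial i u x) * (\sum_i w 0 i * partial i u x).
Proof.
rewrite metric_atE -sum_metric.
by do 2 (apply: eq_bigr => ? _); rewrite induced_metricE.
Qed.

(** Its inverse square root is the time component of the unit normal. *)
Definition slack x := 1 - grad2 x.

Lemma slack_gt0 x : 0 < slack x.
Proof.
rewrite /slack subr_gt0.
have [p0|pn0] := eqVneq (gradient u x) 0.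
  rewrite /grad2 big1 // => i _; have /rowP/(_ i) := p0.
  by rewrite !mxE => ->; rewrite expr0n.
have := sl x pn0; rewrite induced_metric_at.
have -> : \sum_i gradient u x 0 i * gradient u x 0 i = grad2 x.
  by apply: eq_bigr => i _; rewrite !mxE expr2.
have -> : \sum_i gradient u x 0 i * partial i u x = grad2 x.
  by apply: eq_bigr => i _; rewrite !mxE expr2.
have n0 : 0 <= grad2 x by apply: sumr_ge0 => i _; apply: sqr_ge0.
rewrite -{1}[grad2 x]mulr1 -mulrBr => h; nra.
Qed.

(** The metric [I - p^T p] is a rank one perturbation of the identity, so its
    inverse is one as well. *)
Lemma invmx_induced_metric x i j : invmx (induced_metric u x) i j =
  (i == j)%:R + (slack x)^-1 * partial i u x * partial j u x.
Proof.
set p := gradient u x.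
have gE : induced_metric u x = 1%:M - p^T *m p.
  apply/matrixP => a b; rewrite induced_metricE !mxE big_ord1 !mxE.
  done.
have pp : p *m p^T = (grad2 x)%:M.
  apply/matrixP => a b; rewrite !ord1 !mxE eqxx mulr1n.
  by apply: eq_bigr => k _; rewrite !mxE expr2.
set B := 1%:M + (slack x)^-1 *: (p^T *m p).
have AB : induced_metric u x *m B = 1%:M.
  rewrite gE /B mulmxDr mulmx1 -scalemxAr mulmxBl mul1mx.
  rewrite mulmxA -(mulmxA p^T) pp mul_mx_scalar -scalemxAl.
  rewrite -[X in X - _ *: _]scale1r -scalerBl scalerA -/(slack x).
  by rewrite mulVf ?scale1r ?subrK // gt_eqF // slack_gt0.
have [Au _] := mulmx1_unit AB.
have -> : invmx (induced_metric u x) = B.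
  by rewrite -[LHS]mulmx1 -AB mulmxA mulVmx // mul1mx.
by rewrite /B !mxE big_ord1 !mxE mulrA.
Qed.

Lemma isD_slack x v :
  isD x v slack (- 2 * \sum_i partial i u x * 'D_v (partial i u) x).
Proof.
rewrite (_ : slack = fun z => 1 - (partial ord0 u z ^+ 2
    + partial o1 u z ^+ 2 + partial o2 u z ^+ 2)); last first.
  by apply/funext => z; rewrite /slack /grad2 sum3.
rewrite sum3; apply: isD_one_sub_sqr3; apply: isD_partial.
Qed.

(** The derivative of the normalising factor multiplies the normal itself,
    which is orthogonal to the tangent vectors; it drops out. *)
Lemma second_fundamental_formE x i j :
  second_fundamental_form u x i j = (Num.sqrt (slack x))^-1 * hess i j x.
Proof.
rewrite mxE partial_graph minkowski_basis /=.
set w := fun z => (Num.sqrt (slack z))^-1.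
have dw : exists dw, isD x (basis_vec i) w dw.
  eexists; apply: isD_inv; first by rewrite gt_eqF // sqrtr_gt0 slack_gt0.
  by apply: isD_sqrt; [exact: slack_gt0|exact: isD_slack].
have {dw} [dw Hw] := dw.
have nE : unit_normal u = fun z => (w z *: gradient u z, w z).
  by apply/funext => z; rewrite /unit_normal enorm_gradient.
have Hc k : isD x (basis_vec i) (fun z => (w z *: gradient u z) 0 k)
    (w x * hess i k x + partial k u x * dw).
  rewrite (_ : (fun z => _) = (fun z => w z * partial k u z)).
    exact: isD_mul Hw (isD_partial _ _ _).
  by apply/funext => z; rewrite !mxE.
have dV : derivable (fun z => w z *: gradient u z) x (basis_vec i).
  by apply/derivable_mxP => a b; rewrite ord1; have [] := Hc b.
rewrite nE [partial _ _ _](derive_pair dV (isD_derivable Hw)) (isD_val Hw).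
rewrite /= derive_mx // mxE.
by have [_ ->] := Hc j; rewrite [dw * _]mulrC addrK.
Qed.

Lemma isD_partial_basis i m x : isD x (basis_vec m) (partial i u) (hess m i x).
Proof. exact: isD_partial. Qed.

Lemma isD_hess_basis i j m x :
  isD x (basis_vec m) (hess i j) (partial m (hess i j) x).
Proof. exact: isD_hess. Qed.

Lemma isD_slack_basis m x :
  isD x (basis_vec m) slack (- 2 * \sum_l partial l u x * hess m l x).
Proof. exact: isD_slack. Qed.

Lemma slack_inv_mul x : (slack x)^-1 * (1 - \sum_i partial i u x ^+ 2) = 1.
Proof. by rewrite mulVf // gt_eqF // slack_gt0. Qed.

Lemma christoffelE k i j : christoffel (induced_metric u) k i j =
  fun x => - (partial k u x * hess i j x * (slack x)^-1).
Proof.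
apply/funext => x.
have dg l a b : partial l (fun z => induced_metric u z a b) x =
    - (hess l a x * partial b u x + partial a u x * hess l b x).
  have -> : (fun z => induced_metric u z a b) =
      fun z => (a == b)%:R - partial a u z * partial b u z.
    by apply/funext => z; rewrite induced_metricE.
  apply: isD_val; apply: isD_eq.
    by apply: isD_sub; [exact: isD_cst|apply: isD_mul; apply: isD_partial_basis].
  by rewrite sub0r addrC [hess l a x * _]mulrC.
have Hs a b : hess a b x = hess b a x by exact: hess_sym.
apply: etrans (christoffel_algebra (D := fun a b => hess a b x) Hs (slack_inv_mul x) k i j).
rewrite /christoffel; congr (_ * _); apply: eq_bigr => l _.
by rewrite invmx_induced_metric !dg.
Qed.

Lemma partial_christoffel m k i j x :
  partial m (christoffel (induced_metric u) k i j) x =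
  - ((hess m k x * hess i j x + partial k u x * partial m (hess i j) x) * (slack x)^-1
     + 2 * partial k u x * hess i j x * (slack x)^-1 ^+ 2
       * \sum_l partial l u x * hess m l x).
Proof.
rewrite christoffelE; apply: isD_val; apply: isD_eq.
  apply: isD_opp; apply: isD_mul.
    by apply: isD_mul; [exact: isD_partial_basis|exact: isD_hess_basis].
  by apply: isD_inv; [rewrite gt_eqF // slack_gt0|exact: isD_slack_basis].
cbv beta; move: (\sum_l _) (partial k u x) (partial m _ x) (hess m k x) (hess i j x).
by move: (slack x)^-1 => ? ? ? ? ? ?; ring.
Qed.

Lemma ricciE i j x :
  let p i := partial i u x in let D i j := hess i j x in
  let b i := \sum_k p k * D i k in
  ricci (induced_metric u) i j x =
  (slack x)^-1 * (- (\sum_k D k k) * D i j + \sum_k D i k * D j k)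
  + (slack x)^-1 ^+ 2 * (- (\sum_i p i * b i) * D i j + b i * b j).
Proof.
move=> p D b; rewrite -(ricci_algebra _ _ _ (fun k => partial k (hess i j) x)).
rewrite /ricci; congr (_ + _); apply: eq_bigr => k _.
  have E a c : hess a c = hess c a by apply/funext => z; exact: hess_sym.
  have ET : partial j (hess i k) x = partial k (hess i j) x.
    by rewrite (E i k) third_sym (E j i).
  by rewrite 2!partial_christoffel ET.
by apply: eq_bigr => l _; rewrite !christoffelE.
Qed.

Lemma mean_curvatureE x : mean_curvature u x =
  3^-1 * ((Num.sqrt (slack x))^-1 * (\sum_k hess k k x
   + (slack x)^-1 * \sum_i partial i u x * \sum_k partial k u x * hess i k x)).
Proof.
rewrite /mean_curvature; congr (_ * _).
rewrite /mxtrace mulrDr !mulr_sumr -big_split; apply: eq_bigr => i _.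
rewrite mxE.
transitivity (\sum_k ((i == k)%:R * ((Num.sqrt (slack x))^-1 * hess k i x)
   + (Num.sqrt (slack x))^-1 * ((slack x)^-1 * (partial i u x * (partial k u x * hess i k x))))).
  apply: eq_bigr => k _; rewrite invmx_induced_metric second_fundamental_formE.
  rewrite (hess_sym i k).
  move: (partial i u x) (partial k u x) (hess k i x) (slack x)^-1 (i == k)%:R.
  by move: (Num.sqrt (slack x))^-1 => *; ring.
by rewrite big_split sum_delta_l /= !mulr_sumr.
Qed.

Hypothesis cmc : forall x, mean_curvature u x = 1.

(** Gauss equation: with mean curvature 1, the scalar curvature plus 6 is the
    squared norm of the trace-free second fundamental form, measured in the
    induced metric. The Euclidean norm is smaller and easier to use. *)
Lemma frobenius_le_scalar x :
  \sum_i \sum_j ((Num.sqrt (slack x))^-1 * hess i j x - (i == j)%:R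
                 + partial i u x * partial j u x) ^+ 2
  <= scalar_curvature (induced_metric u) x + 6.
Proof.
have Hs i j : hess i j x = hess j i x by exact: hess_sym.
have HW := slack_inv_mul x.
have -> : scalar_curvature (induced_metric u) x =
   (slack x)^-1 * (\sum_i \sum_j hess i j x ^+ 2 - (\sum_k hess k k x) ^+ 2)
   + 2 * (slack x)^-1 ^+ 2 *
     (\sum_i (\sum_k partial k u x * hess i k x) ^+ 2 - (\sum_k hess k k x)
        * \sum_i partial i u x * \sum_k partial k u x * hess i k x).
  apply: etrans (scalar_algebra (fun i => partial i u x) (slack x)^-1 Hs).
  apply: eq_bigr => i _; apply: eq_bigr => j _.
  by rewrite invmx_induced_metric ricciE.
apply: frobenius_algebra => //.
  by rewrite exprVn sqr_sqrtr // ltW // slack_gt0.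
have := cmc x; rewrite mean_curvatureE => E.
have n3 : (3 : R)^-1 != 0 by rewrite invr_eq0 pnatr_eq0.
by apply: (mulfI n3); rewrite E mulVf // pnatr_eq0.
Qed.

End Graph.

(** * Directional form of the umbilicity defect *)

Section Curves.
Context {R : realType} {V : normedModType R}.
Implicit Types (v w : V).

Lemma is_derive_scalel (a : R -> R) v (t da : R) :
  isD t 1 a da -> is_derive t 1 (fun s => a s *: v) (da *: v).
Proof.
move=> [d <-]; have d' : differentiable a t by apply/derivable1_diffP.
have d'' := differentiableZl v d'.
split; first exact: diff_derivable.
by rewrite deriveE // diffZl // -deriveE.
Qed.

Lemma isD_curve2 (f : V -> R) (a b : R -> R) v w (t da db : R) :
  differentiable f (a t *: v + b t *: w) -> isD t 1 a da -> isD t 1 b db ->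
  isD t 1 (fun s => f (a s *: v + b s *: w))
    (da * 'D_v f (a t *: v + b t *: w) + db * 'D_w f (a t *: v + b t *: w)).
Proof.
move=> df ha hb.
have hc : is_derive t 1 (fun s => a s *: v + b s *: w) (da *: v + db *: w).
  exact: is_deriveD (is_derive_scalel v ha) (is_derive_scalel w hb).
have := @derive_comp_curve _ _ f (fun s => a s *: v + b s *: w) t _ df hc.
by rewrite deriveE // linearD !linearZ /= -!deriveE.
Qed.
End Curves.

Section Norms.
Context {R : realType}.

Implicit Types (v w : 'rV[R]_3) (a : R).

Definition dot (v w : 'rV[R]_3) := \sum_i v 0 i * w 0 i.

Lemma cauchy_schwarz3 (a b : 'I_3 -> R) :
  (\sum_i a i * b i) ^+ 2 <= (\sum_i a i ^+ 2) * (\sum_i b i ^+ 2).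
Proof.
rewrite -subr_ge0 !sum3 (_ : _ - _ = (a ord0 * b o1 - a o1 * b ord0) ^+ 2
  + (a ord0 * b o2 - a o2 * b ord0) ^+ 2 + (a o1 * b o2 - a o2 * b o1) ^+ 2);
  last by ring.
by rewrite !addr_ge0 // sqr_ge0.
Qed.

Lemma dot_sqr (v : 'rV[R]_3) : dot v v = \sum_i v 0 i ^+ 2.
Proof. by apply: eq_bigr => i _; rewrite expr2. Qed.

Lemma dot_ge0 (v : 'rV[R]_3) : 0 <= dot v v.
Proof. by rewrite dot_sqr; apply: sumr_ge0 => i _; apply: sqr_ge0. Qed.

Lemma enormE (v : 'rV[R]_3) : enorm v = Num.sqrt (dot v v).
Proof. by rewrite dot_sqr. Qed.

Lemma enorm_sqr (v : 'rV[R]_3) : enorm v ^+ 2 = dot v v.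
Proof. by rewrite enormE sqr_sqrtr // dot_ge0. Qed.

Lemma dotC v w : dot v w = dot w v.
Proof. by apply: eq_bigr => i _; rewrite mulrC. Qed.
Lemma dotDl v v' w : dot (v + v') w = dot v w + dot v' w.
Proof. by rewrite -big_split; apply: eq_bigr => i _; rewrite mxE mulrDl. Qed.
Lemma dotZl a v w : dot (a *: v) w = a * dot v w.
Proof. by rewrite mulr_sumr; apply: eq_bigr => i _; rewrite mxE mulrA. Qed.
Lemma dotDr v v' w : dot w (v + v') = dot w v + dot w v'.
Proof. by rewrite dotC dotDl !(dotC w). Qed.
Lemma dotZr a v w : dot w (a *: v) = a * dot w v.
Proof. by rewrite dotC dotZl (dotC w). Qed.

Lemma enormZ a v : 0 <= a -> enorm (a *: v) = a * enorm v.
Proof.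
move=> a0; rewrite !enormE dotZl dotZr mulrA -expr2 sqrtrM ?sqr_ge0 //.
by rewrite sqrtr_sqr ger0_norm.
Qed.

Lemma enorm_eq1 v : dot v v = 1 -> enorm v = 1.
Proof. by rewrite enormE => ->; rewrite sqrtr1. Qed.

End Norms.

Lemma quadratic_algebra {R : realType} (p v : 'I_3 -> R) (D : 'I_3 -> 'I_3 -> R) w :
  w * (\sum_i v i * \sum_j D i j * v j) - \sum_i v i * v i
    + (\sum_i v i * p i) ^+ 2 =
  \sum_i v i * \sum_j (w * D i j - (i == j)%:R + p i * p j) * v j.
Proof. by rewrite !sum3 /=; ring. Qed.

Section Directional.
Context {R : realType}.
Variable u : 'rV[R]_3 -> R.
Hypothesis su : smooth setT u.

Lemma u_differentiable x : differentiable u x.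
Proof. exact: smooth_differentiable (finite_frame_rV _) openT su I. Qed.

Lemma derive_dir (f : 'rV[R]_3 -> R) v x : differentiable f x ->
  'D_v f x = \sum_i v 0 i * partial i f x.
Proof. by move=> df; rewrite {1}[v]row_sum_delta derive_sum_dir. Qed.

Lemma derive_dirE v x : 'D_v u x = \sum_i v 0 i * partial i u x.
Proof. exact: derive_dir (u_differentiable x). Qed.

Lemma derive_dir2E v x :
  'D_v ('D_v u) x = \sum_i v 0 i * \sum_j hess u i j x * v 0 j.
Proof.
have E : 'D_v u = fun z => v 0 ord0 * partial ord0 u z
    + v 0 o1 * partial o1 u z + v 0 o2 * partial o2 u z.
  by apply/funext => z; rewrite derive_dirE sum3.
have pd i : 'D_v (partial i u) x = \sum_j v 0 j * hess u j i x.
  apply: derive_dir.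
  exact: smooth_differentiable (finite_frame_rV _) openT (smooth_partial su i) I.
have cm i c : isD x v (fun z => c * partial i u z)
    (c * \sum_j v 0 j * hess u j i x).
  apply: isD_eq; first by apply: isD_mul; [exact: isD_cst|exact: isD_partial].
  by rewrite mulr0 addr0 pd.
have -> : 'D_v ('D_v u) x = \sum_i v 0 i * \sum_j v 0 j * hess u j i x.
  rewrite {1}E sum3; apply: isD_val.
  by do 2?[apply: isD_add]; apply: cm.
apply: eq_bigr => i _; congr (_ * _); apply: eq_bigr => j _.
by rewrite (hess_sym su) mulrC.
Qed.

Hypothesis sl : spacelike u.
Hypothesis cmc : forall x, mean_curvature u x = 1.

(** The quantity squared is the trace-free second fundamental form evaluated at
    [(v, v)]. *)
Lemma umbilicity_defect_bound v x :
  ((Num.sqrt (slack u x))^-1 * 'D_v ('D_v u) x - dot v v + 'D_v u x ^+ 2) ^+ 2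
  <= (scalar_curvature (induced_metric u) x + 6) * dot v v ^+ 2.
Proof.
set w := (Num.sqrt _)^-1.
pose A i j := w * hess u i j x - (i == j)%:R + partial i u x * partial j u x.
have -> : w * 'D_v ('D_v u) x - dot v v + 'D_v u x ^+ 2 =
    \sum_i v 0 i * \sum_j A i j * v 0 j.
  by rewrite derive_dir2E derive_dirE /A -quadratic_algebra.
apply: (le_trans (cauchy_schwarz3 _ _)).
rewrite -dot_sqr expr2 mulrCA ler_wpM2l ?dot_ge0 //.
apply: (@le_trans _ _ ((\sum_i \sum_j A i j ^+ 2) * dot v v)); last first.
  by rewrite ler_wpM2r ?dot_ge0 // frobenius_le_scalar.
rewrite mulr_suml; apply: ler_sum => i _.
by rewrite dot_sqr; apply: cauchy_schwarz3.
Qed.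
End Directional.

(** * Expansion of the height function near infinity *)

(** A straight line [y + t e], [e] orthogonal to the unit vector [y], projects
    radially to a great circle. With [m = |e|^2], the point at parameter [t]
    has norm [gc_norm t] and direction [gc_cos t *: y + gc_sin t *: e]. *)
Section GreatCircle.
Context {R : realType}.
Variable m : R.
Hypothesis m0 : 0 <= m.
Implicit Type t : R.

Definition gc_norm (t : R) := Num.sqrt (1 + m * t ^+ 2).
Definition gc_cos (t : R) := (gc_norm t)^-1.
Definition gc_sin (t : R) := t * gc_cos t.

Lemma gc_arg_gt0 t : 0 < 1 + m * t ^+ 2.
Proof. by rewrite ltr_pwDl // mulr_ge0 // sqr_ge0. Qed.

Lemma gc_norm_gt0 t : 0 < gc_norm t.
Proof. by rewrite sqrtr_gt0 gc_arg_gt0. Qed.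

Lemma gc_norm0 : gc_norm 0 = 1.
Proof. by rewrite /gc_norm expr0n mulr0 addr0 sqrtr1. Qed.

Lemma gc_cos0 : gc_cos 0 = 1.
Proof. by rewrite /gc_cos gc_norm0 invr1. Qed.

Lemma gc_sin0 : gc_sin 0 = 0.
Proof. by rewrite /gc_sin mul0r. Qed.

Lemma isD_id (t : R) : isD t 1 (fun s : R => s) 1.
Proof. exact: is_derive_id. Qed.

Lemma isD_gc_norm t : isD t 1 gc_norm (m * t * gc_cos t).
Proof.
apply: isD_eq.
  apply: isD_sqrt; first exact: gc_arg_gt0.
  apply: isD_add; first exact: isD_cst.
  by apply: isD_mul; [exact: isD_cst|apply: isD_sqr; exact: isD_id].
rewrite /gc_cos -/(gc_norm t) invfM; move: (gc_norm t)^-1 => c.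
by field.
Qed.

Lemma isD_gc_cos t : isD t 1 gc_cos (- m * t * gc_cos t ^+ 3).
Proof.
apply: isD_eq.
  by apply: isD_inv; [rewrite gt_eqF // gc_norm_gt0|exact: isD_gc_norm].
by rewrite /gc_cos; move: (gc_norm t)^-1 => c; ring.
Qed.

Lemma isD_gc_sin t :
  isD t 1 gc_sin (gc_cos t - m * t ^+ 2 * gc_cos t ^+ 3).
Proof.
apply: isD_eq; first by apply: isD_mul; [exact: isD_id|exact: isD_gc_cos].
by rewrite /=; ring.
Qed.

Lemma isD_gc_cos' : isD (0 : R) 1 (fun t => - m * t * gc_cos t ^+ 3) (- m).
Proof.
have E : (fun t => - m * t * gc_cos t ^+ 3) =
    (fun t => (- m * t) * (gc_cos t * gc_cos t ^+ 2)).
  by apply/funext => t; rewrite -exprS.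
rewrite E; apply: isD_eq.
  apply: isD_mul; apply: isD_mul;
    [exact: isD_cst|exact: isD_id|exact: isD_gc_cos|apply: isD_sqr; exact: isD_gc_cos].
by rewrite /= gc_cos0; ring.
Qed.

Lemma isD_gc_sin' :
  isD (0 : R) 1 (fun t => gc_cos t - m * t ^+ 2 * gc_cos t ^+ 3) 0.
Proof.
have E : (fun t => gc_cos t - m * t ^+ 2 * gc_cos t ^+ 3) =
    (fun t => gc_cos t + t * (- m * t * gc_cos t ^+ 3)).
  by apply/funext => t; ring.
rewrite E; apply: isD_eq.
  apply: isD_add; first exact: isD_gc_cos.
  by apply: isD_mul; [exact: isD_id|exact: isD_gc_cos'].
by rewrite /= gc_cos0; ring.
Qed.

Lemma isD_gc_combination (g1 g2 : R -> R) (c A B : R) :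
  isD (0 : R) 1 g1 A -> isD (0 : R) 1 g2 B ->
  isD (0 : R) 1 (fun t => m * t * gc_cos t * c
    - (- m * t * gc_cos t ^+ 3 * g1 t
       + (gc_cos t - m * t ^+ 2 * gc_cos t ^+ 3) * g2 t))
    (m * c - (- m * g1 0 + B)).
Proof.
move=> h1 h2; apply: isD_eq.
  apply: isD_sub.
    apply: isD_mul; last exact: isD_cst.
    apply: isD_mul; last exact: isD_gc_cos.
    by apply: isD_mul; [exact: isD_cst|exact: isD_id].
  apply: isD_add; apply: isD_mul.
  - exact: isD_gc_cos'.
  - exact: h1.
  - exact: isD_gc_sin'.
  - exact: h2.
by rewrite /= gc_cos0; ring.
Qed.
End GreatCircle.

Lemma norm_pair0 {R : realType} (V W : normedModType R) (w : W) :
  `|(0 : V, w)| = `|w|.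
Proof. by rewrite prod_normE/= normr0 max_r. Qed.

Lemma derive_scale_dir {R : realType} (V : normedModType R) (f : V -> R) (k : R) v x :
  differentiable f x -> 'D_(k *: v) f x = k * 'D_v f x.
Proof. by move=> df; rewrite !deriveE // linearZ. Qed.

(** [F] is a smooth extension of [P u] in the coordinates [(y, s)], near a
    point of the boundary [s = 0]. The derivatives of [u] at [s^-1 *: y] are
    expressed through those of [F] by restricting [u] to straight lines. *)
Section Local.
Context {R : realType}.
Variable u : 'rV[R]_3 -> R.
Hypothesis su : smooth setT u.
Variables (s0 : R) (U : set ('rV[R]_3 * R)) (F : 'rV[R]_3 * R -> R).
Hypotheses (oU : open U) (sF : smooth U F).
Hypothesis FE : forall y s, dot y y = 1 -> 0 < s <= s0 -> U (y, s) ->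
  F (y, s) = s^-1 - u (s^-1 *: y).

Lemma finite_frame_rV3_R : finite_frame ('rV[R]_3 * R)%type.
Proof. by apply: finite_frame_prod; [exact: finite_frame_rV|exact: finite_frame_scalar]. Qed.

Lemma F_differentiable q : U q -> differentiable F q.
Proof. by move=> Uq; exact: smooth_differentiable finite_frame_rV3_R oU sF Uq. Qed.

Lemma dF_differentiable v q : U q -> differentiable ('D_v F) q.
Proof. by move=> Uq; exact: smooth_differentiable finite_frame_rV3_R oU (smooth_derive v sF) Uq. Qed.

Section AtPoint.
Variables (y : 'rV[R]_3) (s : R).
Hypotheses (y1 : dot y y = 1) (s_gt0 : 0 < s) (Uys : U (y, s)).

Section Tangential.
Hypothesis s_le : s <= s0.
Implicit Type t : R.
Variable e : 'rV[R]_3.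
Hypothesis ey : dot e y = 0.
Let m := dot e e.
Let m0 : 0 <= m := dot_ge0 e.
Let C t : 'rV[R]_3 * R := gc_cos m t *: (y, s) + gc_sin m t *: (e, 0).

Let C0 : C 0 = (y, s).
Proof. by rewrite /C gc_cos0 gc_sin0 scale1r scale0r addr0. Qed.

Let C_near : exists2 d : R, 0 < d & forall t, `|t| < d -> U (C t).
Proof.
have dC : derivable C (0 : R) 1.
  have [dC _] := is_deriveD (is_derive_scalel (y, s) (isD_gc_cos m0 0))
    (is_derive_scalel (e, 0) (isD_gc_sin m0 0)).
  exact: dC.
have cC : {for (0 : R), continuous C}.
  by apply/differentiable_continuous/derivable1_diffP.
have : nbhs (0 : R) (C @^-1` U).
  by apply: cC; apply: open_nbhs_nbhs; split=> //; rewrite C0.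
move=> /nbhs_normP[d /= d0 dP]; exists d => // t td; apply: dP.
by rewrite /= sub0r normrN.
Qed.

(** Along a line orthogonal to the radius, both the direction and the inverse
    radius vary: the line is the curve [C] in the coordinates [(y, s)]. *)
Let u_line t : U (C t) -> u (s^-1 *: y + t *: (s^-1 *: e)) =
  gc_norm m t / s - F (C t).
Proof.
move=> UC; have n0 := gc_norm_gt0 m0 t.
have cE : C t = (gc_cos m t *: (y + t *: e), gc_cos m t * s).
  apply: injective_projections; rewrite /= /gc_sin.
    by rewrite scalerDr scalerA [t * _]mulrC.
  by rewrite [_ *: (0 : R)]scaler0 addr0.
have c0 : 0 < gc_cos m t by rewrite invr_gt0.
rewrite cE FE -?cE //.
- have cs : (gc_cos m t * s)^-1 = gc_norm m t / s by rewrite invfM invrK.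
  have cz (z : 'rV[R]_3) : (gc_cos m t * s)^-1 *: (gc_cos m t *: z) = s^-1 *: z.
    by rewrite scalerA invfM mulrAC mulVf ?gt_eqF // mul1r.
  rewrite cz cs.
  rewrite opprB addrCA subrr addr0.
  by rewrite scalerDr !scalerA [t * _]mulrC.
- rewrite dotZl dotZr mulrA -expr2 dotDl !dotDr !dotZl !dotZr y1.
  rewrite (dotC y e) ey !mulr0 addr0 add0r -/m.
  rewrite (_ : t * (t * m) = m * t ^+ 2); last by ring.
  rewrite /gc_cos exprVn sqr_sqrtr ?(ltW (gc_arg_gt0 m0 t)) //.
  by rewrite mulVf // gt_eqF // gc_arg_gt0.
- rewrite mulr_gt0 //= (le_trans _ s_le) // ler_piMl ?(ltW s_gt0) //.
  rewrite /gc_cos invf_le1 // -[X in X <= _]sqrtr1 ler_wsqrtr //.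
  by rewrite lerDl mulr_ge0 // sqr_ge0.
Qed.

Let isD_F t G : U (C t) -> differentiable G (C t) ->
  isD t 1 (fun t => G (C t))
   (- m * t * gc_cos m t ^+ 3 * 'D_(y, s) G (C t)
    + (gc_cos m t - m * t ^+ 2 * gc_cos m t ^+ 3) * 'D_(e, 0) G (C t)).
Proof.
move=> UC dG.
exact: isD_curve2 dG (isD_gc_cos m0 t) (isD_gc_sin m0 t).
Qed.

Let isD_u (f : 'rV[R]_3 -> R) v x t : differentiable f (x + t *: v) ->
  isD t 1 (fun t : R => f (x + t *: v)) ('D_v f (x + t *: v)).
Proof. by move=> df; apply: is_derive_line; apply: diff_derivable. Qed.

Let du_line t : U (C t) -> (exists2 d, 0 < d & forall t', `|t' - t| < d -> U (C t')) ->
  s^-1 * 'D_e u (s^-1 *: y + t *: (s^-1 *: e)) =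
  m * t * gc_cos m t * s^-1
  - (- m * t * gc_cos m t ^+ 3 * 'D_(y, s) F (C t)
    + (gc_cos m t - m * t ^+ 2 * gc_cos m t ^+ 3) * 'D_(e, 0) F (C t)).
Proof.
move=> UC [d d0 dP].
rewrite -derive_scale_dir; last exact: u_differentiable.
rewrite -(isD_val (isD_u (u_differentiable su _))).
apply: isD_val; apply: (@isD_near _ _ _ _ (fun t => gc_norm m t * s^-1 - F (C t))).
  apply/nbhs_normP; exists d => // t' /=; rewrite distrC => /dP UC'.
  by rewrite u_line.
apply: isD_sub; last by apply: isD_F => //; exact: F_differentiable.
apply: isD_eq; first by apply: isD_mul; [exact: isD_gc_norm|exact: isD_cst].
by rewrite mulr0 add0r mulrC.
Qed.

Lemma tangential_derive : 'D_e u (s^-1 *: y) = - s * 'D_(e, 0) F (y, s).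
Proof.
have [d d0 dP] := C_near.
have := @du_line 0; rewrite C0 scale0r addr0 => /(_ Uys) H.
have {}H := H (ex_intro2 _ _ d d0 (fun t h => dP t (eq_ind _ (fun z => `|z| < d) h _ (subr0 t)))).
move: H; rewrite gc_cos0; move: ('D_e u _) ('D_(y, s) F _) ('D_(e, 0) F _) => a b c H.
have s_neq0 : s != 0 by rewrite gt_eqF.
have -> : a = s * (s^-1 * a) by rewrite mulrA mulfV // mul1r.
by rewrite H; ring.
Qed.

(** The terms proportional to [m] depend on [e] only through its length. They
    disappear when two directions of equal length are compared. *)
Lemma tangential_derive2 : 'D_e ('D_e u) (s^-1 *: y) =
  m * s - s ^+ 2 * ('D_(e, 0) ('D_(e, 0) F) (y, s) - m * 'D_(y, s) F (y, s)).
Proof.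
have [d d0 dP] := C_near.
have s_neq0 : s != 0 by rewrite gt_eqF.
have du : smooth setT ('D_e u) := smooth_derive e su.
have ddu x : differentiable ('D_e u) x.
  exact: smooth_differentiable (finite_frame_rV _) openT du I.
have E1 : isD (0 : R) 1 (fun t : R => s^-1 * 'D_e u (s^-1 *: y + t *: (s^-1 *: e)))
    (s^-1 * (s^-1 * 'D_e ('D_e u) (s^-1 *: y))).
  apply: isD_eq; first by apply: isD_mul; [exact: isD_cst|apply: (isD_u (ddu _))].
  by rewrite mulr0 addr0 scale0r addr0 derive_scale_dir.
have E2 : isD (0 : R) 1 (fun t : R => s^-1 * 'D_e u (s^-1 *: y + t *: (s^-1 *: e)))
    (m * s^-1 - (- m * 'D_(y, s) F (y, s) + 'D_(e, 0) ('D_(e, 0) F) (y, s))).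
  apply: (@isD_near _ _ _ _ (fun t => m * t * gc_cos m t * s^-1
  - (- m * t * gc_cos m t ^+ 3 * 'D_(y, s) F (C t)
    + (gc_cos m t - m * t ^+ 2 * gc_cos m t ^+ 3) * 'D_(e, 0) F (C t)))).
    apply/nbhs_normP; exists d => // t /=; rewrite sub0r normrN => td.
    rewrite du_line; [by []|exact: dP|].
    exists (d - `|t|); first by rewrite subr_gt0.
    move=> t' tt'; apply: dP; rewrite -[t'](subrK t).
    by rewrite (le_lt_trans (ler_normD _ _)) // -ltrBrDr.
  have dF v : differentiable ('D_v F) (C 0).
    by rewrite C0; apply: dF_differentiable.
  have UC0 : U (C 0) by rewrite C0.
  have h1 := isD_F UC0 (dF (y, s)).
  have h2 : isD (0 : R) 1 (fun t => 'D_(e, 0) F (C t))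
      ('D_(e, 0) ('D_(e, 0) F) (y, s)).
    apply: isD_eq (isD_F UC0 (dF (e, 0))) _.
    by rewrite C0 gc_cos0 !mulr0 !mul0r expr0n mulr0 mul0r subr0 add0r mul1r.
  by have := isD_gc_combination m0 s^-1 h1 h2; rewrite C0.
have := isD_val E1; rewrite (isD_val E2).
move: ('D_e ('D_e u) _) ('D_(y, s) F _) ('D_(e, 0) ('D_(e, 0) F) _) => a b c H.
have -> : a = s ^+ 2 * (s^-1 * (s^-1 * a)) by field.
by rewrite -H; field.
Qed.
End Tangential.

(** This makes [|Du|] tend to 1 at the rate [s ^+ 2]. *)
Lemma radial_derive : s < s0 ->
  'D_y u (s^-1 *: y) = 1 + s ^+ 2 * 'D_(0, 1) F (y, s).
Proof.
move=> s_lt.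
have s_neq0 : s != 0 by rewrite gt_eqF.
have E1 : isD s 1 (fun r : R => F ((y, 0) + r *: (0, 1))) ('D_(0, 1) F (y, s)).
  have E : (y, s) = (y, 0) + s *: (0, 1).
    apply: injective_projections; rewrite /= ?scaler0 ?addr0 //.
    by rewrite add0r [_ *: _]mulr1.
  rewrite E; apply: is_derive_line; rewrite -E.
  by apply: diff_derivable; apply: F_differentiable.
have E2 : isD s 1 (fun r : R => F ((y, 0) + r *: (0, 1)))
    (- s^-1 ^+ 2 - (- s^-1 ^+ 2 * 'D_y u (s^-1 *: y))).
  apply: (@isD_near _ _ _ _ (fun r : R => r^-1 - u (r^-1 *: y + 0 *: y))).
    have [d d0 dP] := open_normP oU Uys.
    pose d' := Num.min d (Num.min s (s0 - s)).
    have d'0 : 0 < d' by rewrite !lt_min d0 s_gt0 subr_gt0.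
    apply/nbhs_normP; exists d' => // r /=.
    rewrite !lt_min distrC => /and3P[rd rs rs0].
    rewrite scale0r addr0.
    have -> : (y, 0) + r *: (0, 1) = (y, r) :> 'rV[R]_3 * R.
      apply: injective_projections; rewrite /= ?scaler0 ?addr0 //.
      by rewrite add0r [_ *: _]mulr1.
    have r0 : 0 < r.
      by have := rs; rewrite distrC => /(le_lt_trans (ler_norm _)); lra.
    have rs0' : r <= s0.
      by have := rs0; move=> /(le_lt_trans (ler_norm _)); lra.
    rewrite FE ?r0 //.
    apply: dP; rewrite [X in `|X|](_ : _ = (0, r - s)); last first.
      by apply: injective_projections; rewrite /= ?subrr.
    by rewrite norm_pair0.
  apply: isD_eq.
    apply: isD_sub.
      by apply: isD_inv; [exact: s_neq0|exact: isD_id].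
    apply: isD_curve2; first exact: u_differentiable.
      by apply: isD_inv; [exact: s_neq0|exact: isD_id].
    exact: isD_cst.
  by rewrite mulr1 mul0r addr0 scale0r addr0.
have := isD_val E1; rewrite (isD_val E2).
by move: ('D_y u _) ('D_(0, 1) F _) => a b <-; field.
Qed.
End AtPoint.
End Local.

(** * The leading term at infinity is umbilic *)

(** [a] and [a'] are second derivatives of the height in two directions of
    squared length [m], [A] and [A'] the trace-free second fundamental form
    there. In the difference [A - A'] the terms [m] cancel, and dividing by the
    large factor [w] gains one power of [s]. *)
Lemma tracefree_bound {R : realType} (w A A' a a' p p' X s m c M h : R) : 0 < s -> 0 < X ->
  w = (Num.sqrt X)^-1 ->
  A = w * a - m + p ^+ 2 -> A' = w * a' - m + p' ^+ 2 ->
  0 <= m -> 0 <= c -> A ^+ 2 <= (c * s ^+ 4) * m ^+ 2 -> A' ^+ 2 <= (c * s ^+ 4) * m ^+ 2 ->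
  p ^+ 2 <= s ^+ 2 * M ^+ 2 -> p' ^+ 2 <= s ^+ 2 * M ^+ 2 ->
  a - a' = - s ^+ 2 * h ->
  `|h| <= Num.sqrt X * (2 * (Num.sqrt c * m + M ^+ 2)).
Proof.
move=> s0' X0 wE AE A'E m0 c0 hA hA' hp hp' E.
have r0 : 0 < Num.sqrt X by rewrite sqrtr_gt0.
have w0 : 0 < w by rewrite wE invr_gt0.
have k0 : 0 <= Num.sqrt c * m by rewrite mulr_ge0 // sqrtr_ge0.
have absB (B : R) : B ^+ 2 <= (c * s ^+ 4) * m ^+ 2 -> `|B| <= s ^+ 2 * (Num.sqrt c * m).
  move=> hB; rewrite -(@ler_pXn2r _ 2) ?nnegrE ?mulr_ge0 ?sqr_ge0 ?sqrtr_ge0 ?(ltW s0') //.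
  rewrite real_normK ?num_real // !exprMn sqr_sqrtr //.
  by rewrite (le_trans hB) // le_eqVlt; apply/orP; left; apply/eqP; ring.
have hb1 := absB _ hA; rewrite ler_norml in hb1; move: hb1 => /andP[A1 A2].
have hb2 := absB _ hA'; rewrite ler_norml in hb2; move: hb2 => /andP[A3 A4].
move: (Num.sqrt c * m) k0 A1 A2 A3 A4 => k k0 A1 A2 A3 A4.
rewrite -ler_pdivrMl // -wE -(@ler_pM2l _ (s ^+ 2)) ?exprn_gt0 //.
rewrite -(normrM_pos _ w0) -(normrM_pos _ (exprn_gt0 2 s0')).
have -> : s ^+ 2 * (w * h) = - (w * (a - a')) by rewrite E; ring.
have -> : w * (a - a') = A - A' - p ^+ 2 + p' ^+ 2 by rewrite AE A'E; ring.
have p0 := sqr_ge0 p; have p'0 := sqr_ge0 p'.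
have -> : s ^+ 2 * (2 * (k + M ^+ 2)) = 2 * (s ^+ 2 * k) + 2 * (s ^+ 2 * M ^+ 2) by ring.
rewrite normrN ler_norml; apply/andP; split; lra.
Qed.

Lemma half_norm_lt {R : realType} (a b : R) :
  `|a - b| < `|b| / 2 -> `|b| / 2 < `|a|.
Proof.
move=> h; have := ler_normB a (a - b).
rewrite subKr; lra.
Qed.

Section Umbilic.
Context {R : realType}.
Variable u : 'rV[R]_3 -> R.
Hypothesis su : smooth setT u.
Hypothesis sl : spacelike u.
Hypothesis cmc : forall x, mean_curvature u x = 1.
Hypothesis hS : bigO_s (fun x => `|scalar_curvature (induced_metric u) x + 6|) 4.
Variables (s0 : R) (U : set ('rV[R]_3 * R)) (F : 'rV[R]_3 * R -> R).
Hypotheses (s0_gt0 : 0 < s0) (oU : open U) (sF : smooth U F).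
Hypothesis FE : forall y s, dot y y = 1 -> 0 < s <= s0 -> U (y, s) ->
  F (y, s) = s^-1 - u (s^-1 *: y).

(** [|Du|^2] is at least the square of the radial derivative. *)
Lemma slack_le y s M : dot y y = 1 -> 0 < s < s0 -> s <= 1 -> U (y, s) ->
  `|'D_(0, 1) F (y, s)| <= M -> slack u (s^-1 *: y) <= s ^+ 2 * (M * (2 + M)).
Proof.
move=> y1 /andP[s_gt0 s_lt] s1 Uys gM.
have := cauchy_schwarz3 (fun i => y 0 i) (fun i => partial i u (s^-1 *: y)).
rewrite -(derive_dirE su) -dot_sqr y1 mul1r.
rewrite (radial_derive su oU sF FE y1 s_gt0 Uys s_lt) /slack /grad2.
move: (\sum_i _) ('D_(0, 1) F _) gM => n g; rewrite ler_norml => /andP[g1 g2] h.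
have M0 : 0 <= M by lra.
have s2 : s ^+ 2 <= 1 by rewrite expr_le1 // ltW.
have s20 : 0 <= s ^+ 2 by exact: sqr_ge0.
move: (s ^+ 2) s2 s20 h => q q1 q0 h.
apply: (@le_trans _ _ (q * (- g * (2 + q * g)))); first by nra.
rewrite ler_wpM2l //.
have [g0|g0] := leP 0 g; first by nra.
nra.
Qed.

Lemma continuous_axis (G : 'rV[R]_3 * R -> R) y e : U (y, 0) ->
  {for (y, 0), continuous G} -> 0 < e ->
  exists2 d : R, 0 < d & forall s : R, 0 < s < d ->
    U (y, s) /\ `|G (y, s) - G (y, 0)| < e.
Proof.
move=> Uy cG e0.
have [d d0 dP] := open_normP oU Uy.
have [d' d'0 d'P] := (continuous_forP _ _).1 cG e e0.
exists (Num.min d d'); first by rewrite lt_min d0.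
move=> s /andP[s_gt0]; rewrite lt_min => /andP[sd sd'].
have E : `|(y, s) - (y, 0)| = s.
  rewrite [X in `|X|](_ : _ = (0, s)) ?norm_pair0 ?gtr0_norm //.
  by apply: injective_projections; rewrite /= ?subrr ?subr0.
by split; [apply: dP|apply: d'P]; rewrite E.
Qed.

Lemma derive_bounded_axis v y : U (y, 0) ->
  exists M d : R, [/\ 0 < M, 0 < d & forall s : R, 0 < s < d ->
    U (y, s) /\ `|'D_v F (y, s)| <= M].
Proof.
move=> Uy; have cG := smooth_continuous (smooth_derive v sF) Uy.
have [d d0 dP] := continuous_axis Uy cG ltr01.
exists (`|'D_v F (y, 0)| + 1), d; split=> [||s /dP[Us h]] //.
split=> //.
rewrite -[X in `|X|](subrK ('D_v F (y, 0))) (le_trans (ler_normD _ _)) //.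
by rewrite addrC lerD2l ltW.
Qed.

(** By [tangential_derive2] the difference of the two derivatives at [(y, s)]
    is a multiple of the difference of the second derivatives of [u], which
    [tracefree_bound] controls by [K * s]; let [s] tend to 0. *)
Lemma umbilic_at_infinity y e e' : dot y y = 1 -> U (y, 0) ->
  dot e y = 0 -> dot e' y = 0 -> dot e e = dot e' e' ->
  'D_(e, 0) ('D_(e, 0) F) (y, 0) = 'D_(e', 0) ('D_(e', 0) F) (y, 0).
Proof.
move=> y1 Uy ey e'y ee'.
set h := fun q => 'D_(e, 0) ('D_(e, 0) F) q - 'D_(e', 0) ('D_(e', 0) F) q.
apply/eqP; rewrite -subr_eq0 -[X in X == 0]/(h (y, 0)); apply/negPn/negP => h0.
have hpos : 0 < `|h (y, 0)| by rewrite normr_gt0.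
have ch : {for (y, 0), continuous h}.
  by apply: continuousB; apply: (smooth_continuous (U := U)) => //;
     do 2 apply: smooth_derive.
have [d1 d10 P1] := continuous_axis Uy ch (divr_gt0 hpos (ltr0n _ 2)).
have [M2 [d2 [M20 d20 P2]]] := derive_bounded_axis (e, 0) Uy.
have [M3 [d3 [M30 d30 P3]]] := derive_bounded_axis (e', 0) Uy.
have [M4 [d4 [M40 d40 P4]]] := derive_bounded_axis (0, 1) Uy.
have [C [s1 [s10 PS]]] := hS.
pose M := M2 + M3; pose L := M4 * (2 + M4).
have L0 : 0 < L by rewrite mulr_gt0 // addr_gt0.
pose m := dot e e; have m0 : 0 <= m := dot_ge0 e.
pose K := Num.sqrt L * (2 * (Num.sqrt `|C| * m + M ^+ 2)).
have K0 : 0 < K.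
  rewrite mulr_gt0 ?sqrtr_gt0 // mulr_gt0 // ltr_wpDl ?exprn_gt0 ?addr_gt0 //.
  by rewrite mulr_ge0 ?sqrtr_ge0.
(* the last entry makes [K * s] smaller than half of the alleged gap *)
pose d := Num.min (Num.min (Num.min d1 d2) (Num.min d3 d4))
  (Num.min (Num.min s1 s0) (Num.min 1 (`|h (y, 0)| / (2 * K)))).
have d0 : 0 < d.
  by rewrite !lt_min d10 d20 d30 d40 s10 s0_gt0 ltr01 divr_gt0 // mulr_gt0.
pose s := d / 2.
have s_gt0 : 0 < s by rewrite divr_gt0.
have sd : s < d by rewrite ltr_pdivrMr // ltr_pMr // ltr1n.
have := sd; rewrite !lt_min => /andP[/andP[/andP[sd1 sd2] /andP[sd3 sd4]]].
move=> /andP[/andP[ss1 ss0] /andP[s1' sK]].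
have [Us hs] := P1 s (introT andP (conj s_gt0 sd1)).
have [_ h2] := P2 s (introT andP (conj s_gt0 sd2)).
have [_ h3] := P3 s (introT andP (conj s_gt0 sd3)).
have [_ h4] := P4 s (introT andP (conj s_gt0 sd4)).
have sS : 0 < s <= s1 by rewrite s_gt0 ltW.
have := PS y s (enorm_eq1 y1) sS; rewrite /at_infinity /= normr_id => hSs.
set x := s^-1 *: y in hSs *.
have X0 := slack_gt0 su sl x.
have XL : slack u x <= s ^+ 2 * L.
  by apply: slack_le => //; rewrite ?s_gt0 // ltW.
have Sle : scalar_curvature (induced_metric u) x + 6 <= `|C| * s ^+ 4.
  rewrite (le_trans (ler_norm _)) // (le_trans hSs) // ler_wpM2r ?ler_norm //.
  by rewrite exprn_ge0 // ltW.
have b v : ((Num.sqrt (slack u x))^-1 * 'D_v ('D_v u) x - dot v v + 'D_v u x ^+ 2) ^+ 2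
    <= `|C| * s ^+ 4 * dot v v ^+ 2.
  rewrite (le_trans (umbilicity_defect_bound su sl cmc v x)) //.
  by rewrite ler_wpM2r // sqr_ge0.
have be := b e; have be' := b e'; rewrite -ee' in be'.
have p2 v N : `|'D_(v, 0) F (y, s)| <= N -> N <= M -> dot v y = 0 ->
    'D_v u x ^+ 2 <= s ^+ 2 * M ^+ 2.
  move=> hN NM vy.
  rewrite (tangential_derive su oU sF FE y1 s_gt0 Us (ltW ss0) vy).
  rewrite mulNr sqrrN exprMn ler_wpM2l ?sqr_ge0 // -real_normK ?num_real //.
  by rewrite lerXn2r ?nnegrE // ?(le_trans hN) // addr_ge0 // ltW.
have := @tracefree_bound _ _ _ _ _ _ _ _ _ s m `|C| M (h (y, s)) s_gt0 X0 erefl erefl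
  erefl m0 (normr_ge0 _) be be'
  (p2 e _ h2 _ ey) (p2 e' _ h3 _ e'y).
rewrite lerDl lerDr (ltW M20) (ltW M30) => /(_ isT isT).
rewrite (tangential_derive2 su oU sF FE y1 s_gt0 Us (ltW ss0) ey).
rewrite (tangential_derive2 su oU sF FE y1 s_gt0 Us (ltW ss0) e'y) -ee' -/m.
have -> : forall a b c : R, (m * s - s ^+ 2 * (a - c)) - (m * s - s ^+ 2 * (b - c))
    = - s ^+ 2 * (a - b) by move=> *; ring.
move=> /(_ erefl) hb.
have {}hb : `|h (y, s)| <= K * s.
  apply: (le_trans hb); rewrite /K mulrAC ler_wpM2r //.
    by rewrite mulr_ge0 // addr_ge0 ?sqr_ge0 // mulr_ge0 ?sqrtr_ge0.
  have -> : Num.sqrt L * s = Num.sqrt (s ^+ 2 * L).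
    by rewrite (sqrtrM L (sqr_ge0 s)) sqrtr_sqr (gtr0_norm s_gt0) mulrC.
  exact: ler_wsqrtr.
have hK : K * s < `|h (y, 0)| / 2.
  by rewrite mulrC -ltr_pdivlMr // -mulrA -invfM.
by have := lt_trans (le_lt_trans hb hK) (half_norm_lt hs); rewrite ltxx.
Qed.
End Umbilic.

(** * Stereographic coordinates on the sphere *)

(** Turns the equality of pure second derivatives in directions of equal length
    into the vanishing of mixed ones. *)
Lemma polarization {R : realType} (e e' : 'I_3 -> R) (H : 'I_3 -> 'I_3 -> R) :
  (forall i j, H i j = H j i) ->
  \sum_i \sum_j (e i + e' i) * (e j + e' j) * H i j =
  \sum_i \sum_j (e i - e' i) * (e j - e' j) * H i j ->
  \sum_i \sum_j e i * e' j * H i j = 0.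
Proof.
move=> Hs; rewrite !sum3 (Hs o1 ord0) (Hs o2 ord0) (Hs o2 o1) => E; lra.
Qed.

Section Vec3.
Context {R : realType}.
Implicit Types a b c : R.

Definition vec3 a b c : 'rV[R]_3 :=
  a *: basis_vec ord0 + b *: basis_vec o1 + c *: basis_vec o2.

Lemma vec3E0 a b c : vec3 a b c 0 ord0 = a.
Proof. by rewrite !mxE /=; ring. Qed.
Lemma vec3E1 a b c : vec3 a b c 0 o1 = b.
Proof. by rewrite !mxE /=; ring. Qed.
Lemma vec3E2 a b c : vec3 a b c 0 o2 = c.
Proof. by rewrite !mxE /=; ring. Qed.
Definition vec3E := (vec3E0, vec3E1, vec3E2).

Lemma vec3_eta (v : 'rV[R]_3) : v = vec3 (v 0 ord0) (v 0 o1) (v 0 o2).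
Proof.
rewrite [LHS]row_sum_delta !big_ord_recl big_ord0 addr0 addrA /vec3 /basis_vec.
by congr (_ *: delta_mx 0 _ + _ *: delta_mx 0 _ + _ *: delta_mx 0 _);
  try (congr (v 0 _)); apply/val_inj.
Qed.

Lemma dot_vec3 a b c a' b' c' :
  dot (vec3 a b c) (vec3 a' b' c') = a * a' + b * b' + c * c'.
Proof. by rewrite /dot sum3 !vec3E. Qed.

Lemma quad_vec3 a b c a' b' c' (H : 'I_3 -> 'I_3 -> R) :
  \sum_i \sum_j vec3 a b c 0 i * vec3 a' b' c' 0 j * H i j =
  a * a' * H ord0 ord0 + a * b' * H ord0 o1 + a * c' * H ord0 o2
  + (b * a' * H o1 ord0 + b * b' * H o1 o1 + b * c' * H o1 o2)
  + (c * a' * H o2 ord0 + c * b' * H o2 o1 + c * c' * H o2 o2).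
Proof. by rewrite !sum3 !vec3E. Qed.

Lemma isD_curve3 (f : 'rV[R]_3 -> R) (a b c : R -> R) (t da db dc : R) :
  differentiable f (vec3 (a t) (b t) (c t)) ->
  isD t 1 a da -> isD t 1 b db -> isD t 1 c dc ->
  isD t 1 (fun s => f (vec3 (a s) (b s) (c s)))
    (da * partial ord0 f (vec3 (a t) (b t) (c t))
     + db * partial o1 f (vec3 (a t) (b t) (c t))
     + dc * partial o2 f (vec3 (a t) (b t) (c t))).
Proof.
move=> df ha hb hc.
have hc' := is_deriveD (is_deriveD (is_derive_scalel (basis_vec ord0) ha)
  (is_derive_scalel (basis_vec o1) hb)) (is_derive_scalel (basis_vec o2) hc).
have := @derive_comp_curve _ _ f (fun s => vec3 (a s) (b s) (c s)) t _ df hc'.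
by rewrite deriveE // !linearD !linearZ /= -!deriveE.
Qed.

Lemma continuous_curve3 (a b c : R -> R) (t da db dc : R) :
  isD t 1 a da -> isD t 1 b db -> isD t 1 c dc ->
  {for t, continuous (fun s => vec3 (a s) (b s) (c s))}.
Proof.
move=> ha hb hc.
have [d _] := is_deriveD (is_deriveD (is_derive_scalel (basis_vec ord0) ha)
  (is_derive_scalel (basis_vec o1) hb)) (is_derive_scalel (basis_vec o2) hc).
by apply/differentiable_continuous/derivable1_diffP.
Qed.

(** Reduces iterated derivatives in variable directions to the finitely many
    numbers [partial i (partial j F) z]. *)
Lemma derive2_coord (U : set 'rV[R]_3) (F : 'rV[R]_3 -> R) v w z :
  open U -> smooth U F -> U z ->
  'D_v ('D_w F) z = \sum_i \sum_j v 0 i * w 0 j * partial i (partial j F) z.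
Proof.
move=> oU sF Uz.
have dF x : U x -> differentiable F x.
  exact: smooth_differentiable (finite_frame_rV _) oU sF.
have dpF j : differentiable (partial j F) z.
  exact: smooth_differentiable (finite_frame_rV _) oU (smooth_derive _ sF) Uz.
have E : isD z v ('D_w F) (\sum_j w 0 j * 'D_v (partial j F) z).
  apply: (@isD_near _ _ _ _ (fun x => w 0 ord0 * partial ord0 F x
     + w 0 o1 * partial o1 F x + w 0 o2 * partial o2 F x)).
    have [d d0 dP] := open_normP oU Uz.
    apply/nbhs_normP; exists d => // x /=; rewrite distrC => /dP Ux.
    by rewrite derive_dir ?sum3 //; apply: dF.
  have cm j : isD z v (fun x => w 0 j * partial j F x) (w 0 j * 'D_v (partial j F) z).
    apply: isD_eq.
      by apply: isD_mul; [exact: isD_cst|apply: derivable_isD; apply: diff_derivable].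
    by rewrite mulr0 addr0.
  by rewrite sum3; do 2?[apply: isD_add]; apply: cm.
rewrite (isD_val E) exchange_big; apply: eq_bigr => j _.
rewrite (derive_dir _ (dpF j)) mulr_sumr; apply: eq_bigr => i _.
by rewrite mulrA [w 0 j * _]mulrC.
Qed.
End Vec3.

Section Stereographic.
Context {R : realType}.
Implicit Types a b : R.

(** The conformal factor of the inverse stereographic projection. *)
Definition cfac a b : R := 2 * (1 + a ^+ 2 + b ^+ 2)^-1.
Definition stereo a b := vec3 (a * cfac a b) (b * cfac a b) (1 - cfac a b).

Lemma cfac_den_gt0 a b : 0 < 1 + a ^+ 2 + b ^+ 2.
Proof. by rewrite -addrA ltr_pwDl // addr_ge0 // sqr_ge0. Qed.

Lemma cfac_gt0 a b : 0 < cfac a b.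
Proof. by rewrite mulr_gt0 // invr_gt0 cfac_den_gt0. Qed.

Lemma cfac_rel a b : cfac a b * (1 + a ^+ 2 + b ^+ 2) = 2.
Proof. by rewrite /cfac mulfVK // gt_eqF // cfac_den_gt0. Qed.

Lemma cfacC a b : cfac a b = cfac b a.
Proof. by rewrite /cfac addrAC. Qed.

Lemma isD_cfac1 a b : isD a 1 (cfac^~ b) (- a * cfac a b ^+ 2).
Proof.
apply: isD_eq.
  apply: isD_mul; first exact: isD_cst.
  apply: isD_inv; first by rewrite gt_eqF // cfac_den_gt0.
  apply: isD_add; last exact: isD_cst.
  by apply: isD_add; [exact: isD_cst|apply: isD_sqr; exact: isD_id].
rewrite /= /cfac; move: (_^-1) => i; ring.
Qed.

Lemma isD_cfac2 a b : isD b 1 (cfac a) (- b * cfac a b ^+ 2).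
Proof.
have E : cfac^~ a = cfac a by apply/funext => t; rewrite cfacC.
by have := isD_cfac1 b a; rewrite E (cfacC b a).
Qed.

Lemma stereo_sphere a b : dot (stereo a b) (stereo a b) = 1.
Proof.
rewrite dot_vec3; have := cfac_rel a b; move: (cfac a b) => r rel.
have -> : a * r * (a * r) + b * r * (b * r) + (1 - r) * (1 - r)
  = r * (r * (1 + a ^+ 2 + b ^+ 2)) - 2 * r + 1 by ring.
by rewrite rel; ring.
Qed.

(** The coordinate vector fields of the chart divided by [cfac]; the chart is
    conformal, so they are orthonormal. *)
Definition tan1 a b := vec3 (1 - a ^+ 2 * cfac a b) (- a * b * cfac a b) (a * cfac a b).
Definition tan2 a b := vec3 (- a * b * cfac a b) (1 - b ^+ 2 * cfac a b) (b * cfac a b).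

Lemma tan1_stereo a b : dot (tan1 a b) (stereo a b) = 0.
Proof.
rewrite dot_vec3; have := cfac_rel a b; move: (cfac a b) => r rel.
transitivity (a * r * (2 - r * (1 + a ^+ 2 + b ^+ 2))); first by ring.
by rewrite rel; ring.
Qed.

Lemma tan2_stereo a b : dot (tan2 a b) (stereo a b) = 0.
Proof.
rewrite dot_vec3; have := cfac_rel a b; move: (cfac a b) => r rel.
transitivity (b * r * (2 - r * (1 + a ^+ 2 + b ^+ 2))); first by ring.
by rewrite rel; ring.
Qed.

Lemma tan11 a b : dot (tan1 a b) (tan1 a b) = 1.
Proof.
rewrite dot_vec3; have := cfac_rel a b; move: (cfac a b) => r rel.
transitivity (1 + a ^+ 2 * r * (r * (1 + a ^+ 2 + b ^+ 2) - 2)); first by ring.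
by rewrite rel; ring.
Qed.

Lemma tan22 a b : dot (tan2 a b) (tan2 a b) = 1.
Proof.
rewrite dot_vec3; have := cfac_rel a b; move: (cfac a b) => r rel.
transitivity (1 + b ^+ 2 * r * (r * (1 + a ^+ 2 + b ^+ 2) - 2)); first by ring.
by rewrite rel; ring.
Qed.

Lemma tan12 a b : dot (tan1 a b) (tan2 a b) = 0.
Proof.
rewrite dot_vec3; have := cfac_rel a b; move: (cfac a b) => r rel.
transitivity (a * b * r * (r * (1 + a ^+ 2 + b ^+ 2) - 2)); first by ring.
by rewrite rel; ring.
Qed.

(** Second derivatives in the chart, with the values of the extension and of
    its derivatives along the coordinate lines as abstract functions [f] and
    [q i], and its Hessian at the base point as [H]. *)
Section ChartAlgebra.
Variables (a b : R) (f : R -> R) (q : 'I_3 -> R -> R) (H : 'I_3 -> 'I_3 -> R).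
Hypothesis H_sym : forall i j, H i j = H j i.

Let T1 (g : 'I_3 -> R) := cfac a b * ((1 - a ^+ 2 * cfac a b) * g ord0
  + (- a * b * cfac a b) * g o1 + (a * cfac a b) * g o2).
Let T2 (g : 'I_3 -> R) := cfac a b * ((- a * b * cfac a b) * g ord0
  + (1 - b ^+ 2 * cfac a b) * g o1 + (b * cfac a b) * g o2).
Let quad (e e' : 'rV[R]_3) := \sum_i \sum_j e 0 i * e' 0 j * H i j.

Lemma isD_chart_algebra12 :
  isD b 1 f (T2 (q^~ b)) -> (forall i, isD b 1 (q i) (T2 (H^~ i))) ->
  quad (tan1 a b) (tan2 a b) = 0 ->
  isD b 1 (fun t => a * f t + (1 - a ^+ 2 * cfac a t) * q ord0 t
    + (- a * t * cfac a t) * q o1 t + (a * cfac a t) * q o2 t) 0.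
Proof.
move=> hf hq D0; apply: isD_eq.
  apply: isD_add; last first.
    apply: isD_mul; last exact: hq.
    by apply: isD_mul; [exact: isD_cst|exact: isD_cfac2].
  apply: isD_add; last first.
    apply: isD_mul; last exact: hq.
    apply: isD_mul; last exact: isD_cfac2.
    by apply: isD_mul; [exact: isD_cst|exact: isD_id].
  apply: isD_add; last first.
    apply: isD_mul; last exact: hq.
    apply: isD_sub; first exact: isD_cst.
    by apply: isD_mul; [exact: isD_cst|exact: isD_cfac2].
  by apply: isD_mul; [exact: isD_cst|exact: hf].
move: D0; rewrite /quad quad_vec3 /T2 /= => D0.
rewrite (H_sym o1 ord0) (H_sym o2 ord0) (H_sym o2 o1) in D0 *.
by move: (cfac a b) D0 => r D0; rewrite -[RHS](mulr0 r) -[in RHS]D0; ring.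
Qed.

Lemma isD_chart_algebra21 :
  isD a 1 f (T1 (q^~ a)) -> (forall i, isD a 1 (q i) (T1 (H^~ i))) ->
  quad (tan1 a b) (tan2 a b) = 0 ->
  isD a 1 (fun t => b * f t + (- t * b * cfac t b) * q ord0 t
    + (1 - b ^+ 2 * cfac t b) * q o1 t + (b * cfac t b) * q o2 t) 0.
Proof.
move=> hf hq D0; apply: isD_eq.
  apply: isD_add; last first.
    apply: isD_mul; last exact: hq.
    by apply: isD_mul; [exact: isD_cst|exact: isD_cfac1].
  apply: isD_add; last first.
    apply: isD_mul; last exact: hq.
    apply: isD_sub; first exact: isD_cst.
    by apply: isD_mul; [exact: isD_cst|exact: isD_cfac1].
  apply: isD_add; last first.
    apply: isD_mul; last exact: hq.
    apply: isD_mul; last exact: isD_cfac1.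
    apply: isD_mul; last exact: isD_cst.
    by apply: isD_opp; exact: isD_id.
  by apply: isD_mul; [exact: isD_cst|exact: hf].
move: D0; rewrite /quad quad_vec3 /T1 /= => D0.
rewrite (H_sym o1 ord0) (H_sym o2 ord0) (H_sym o2 o1) in D0 *.
by move: (cfac a b) D0 => r D0; rewrite -[RHS](mulr0 r) -[in RHS]D0; ring.
Qed.

Lemma isD_chart_algebra11 :
  isD a 1 f (T1 (q^~ a)) -> (forall i, isD a 1 (q i) (T1 (H^~ i))) ->
  isD a 1 (fun t => t * f t + (1 - t ^+ 2 * cfac t b) * q ord0 t
    + (- t * b * cfac t b) * q o1 t + (t * cfac t b) * q o2 t)
   (f a - a * cfac a b * q ord0 a - b * cfac a b * q o1 a + cfac a b * q o2 a
    + cfac a b * quad (tan1 a b) (tan1 a b)).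
Proof.
move=> hf hq; apply: isD_eq.
  apply: isD_add; last first.
    apply: isD_mul; last exact: hq.
    by apply: isD_mul; [exact: isD_id|exact: isD_cfac1].
  apply: isD_add; last first.
    apply: isD_mul; last exact: hq.
    apply: isD_mul; last exact: isD_cfac1.
    apply: isD_mul; last exact: isD_cst.
    by apply: isD_opp; exact: isD_id.
  apply: isD_add; last first.
    apply: isD_mul; last exact: hq.
    apply: isD_sub; first exact: isD_cst.
    apply: isD_mul; last exact: isD_cfac1.
    by apply: isD_sqr; exact: isD_id.
  by apply: isD_mul; [exact: isD_id|exact: hf].
rewrite /quad quad_vec3 /T1 /= (H_sym o1 ord0) (H_sym o2 ord0) (H_sym o2 o1).
by move: (cfac a b) => r; ring.
Qed.

Lemma isD_chart_algebra22 :
  isD b 1 f (T2 (q^~ b)) -> (forall i, isD b 1 (q i) (T2 (H^~ i))) ->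
  isD b 1 (fun t => t * f t + (- a * t * cfac a t) * q ord0 t
    + (1 - t ^+ 2 * cfac a t) * q o1 t + (t * cfac a t) * q o2 t)
   (f b - a * cfac a b * q ord0 b - b * cfac a b * q o1 b + cfac a b * q o2 b
    + cfac a b * quad (tan2 a b) (tan2 a b)).
Proof.
move=> hf hq; apply: isD_eq.
  apply: isD_add; last first.
    apply: isD_mul; last exact: hq.
    by apply: isD_mul; [exact: isD_id|exact: isD_cfac2].
  apply: isD_add; last first.
    apply: isD_mul; last exact: hq.
    apply: isD_sub; first exact: isD_cst.
    apply: isD_mul; last exact: isD_cfac2.
    by apply: isD_sqr; exact: isD_id.
  apply: isD_add; last first.
    apply: isD_mul; last exact: hq.
    apply: isD_mul; last exact: isD_cfac2.
    by apply: isD_mul; [exact: isD_cst|exact: isD_id].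
  by apply: isD_mul; [exact: isD_id|exact: hf].
rewrite /quad quad_vec3 /T2 /= (H_sym o1 ord0) (H_sym o2 ord0) (H_sym o2 o1).
by move: (cfac a b) => r; ring.
Qed.
End ChartAlgebra.

Section LocalChart.
Variables (U : set 'rV[R]_3) (F : 'rV[R]_3 -> R).
Hypotheses (oU : open U) (sF : smooth U F).

Lemma isD_stereo1 (G : 'rV[R]_3 -> R) a b : differentiable G (stereo a b) ->
  isD a 1 (fun t => G (stereo t b)) (cfac a b *
    ((1 - a ^+ 2 * cfac a b) * partial ord0 G (stereo a b)
     + (- a * b * cfac a b) * partial o1 G (stereo a b)
     + (a * cfac a b) * partial o2 G (stereo a b))).
Proof.
move=> dG; apply: isD_eq.
  apply: (@isD_curve3 _ G (fun t => t * cfac t b) (fun t => b * cfac t b)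
    (fun t => 1 - cfac t b) a _ _ _ dG).
  - by apply: isD_mul; [exact: isD_id|exact: isD_cfac1].
  - by apply: isD_mul; [exact: isD_cst|exact: isD_cfac1].
  - by apply: isD_sub; [exact: isD_cst|exact: isD_cfac1].
rewrite -/(stereo a b) /=; move: (partial _ _ _) (partial _ _ _) (partial _ _ _).
by move: (cfac a b) => *; ring.
Qed.

Lemma isD_stereo2 (G : 'rV[R]_3 -> R) a b : differentiable G (stereo a b) ->
  isD b 1 (fun t => G (stereo a t)) (cfac a b *
    ((- a * b * cfac a b) * partial ord0 G (stereo a b)
     + (1 - b ^+ 2 * cfac a b) * partial o1 G (stereo a b)
     + (b * cfac a b) * partial o2 G (stereo a b))).
Proof.
move=> dG; apply: isD_eq.
  apply: (@isD_curve3 _ G (fun t => a * cfac a t) (fun t => t * cfac a t)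
    (fun t => 1 - cfac a t) b _ _ _ dG).
  - by apply: isD_mul; [exact: isD_cst|exact: isD_cfac2].
  - by apply: isD_mul; [exact: isD_id|exact: isD_cfac2].
  - by apply: isD_sub; [exact: isD_cst|exact: isD_cfac2].
rewrite -/(stereo a b) /=; move: (partial _ _ _) (partial _ _ _) (partial _ _ _).
by move: (cfac a b) => *; ring.
Qed.

Lemma stereo_near1 a b : U (stereo a b) -> \near a, U (stereo a b).
Proof.
move=> Uc.
have : {for a, continuous (fun t => stereo t b)}.
  apply: (continuous_curve3 (a := fun t => t * cfac t b) (b := fun t => b * cfac t b)
    (c := fun t => 1 - cfac t b)).
  - by apply: isD_mul; [exact: isD_id|exact: isD_cfac1].
  - by apply: isD_mul; [exact: isD_cst|exact: isD_cfac1].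
  - by apply: isD_sub; [exact: isD_cst|exact: isD_cfac1].
by apply; apply: open_nbhs_nbhs.
Qed.

Lemma stereo_near2 a b : U (stereo a b) -> \near b, U (stereo a b).
Proof.
move=> Uc.
have : {for b, continuous (fun t => stereo a t)}.
  apply: (continuous_curve3 (a := fun t => a * cfac a t) (b := fun t => t * cfac a t)
    (c := fun t => 1 - cfac a t)).
  - by apply: isD_mul; [exact: isD_cst|exact: isD_cfac2].
  - by apply: isD_mul; [exact: isD_id|exact: isD_cfac2].
  - by apply: isD_sub; [exact: isD_cst|exact: isD_cfac2].
by apply; apply: open_nbhs_nbhs.
Qed.

Hypothesis umb : forall z e e', U z -> dot z z = 1 -> dot e z = 0 ->
  dot e' z = 0 -> dot e e = dot e' e' ->
  'D_e ('D_e F) z = 'D_e' ('D_e' F) z.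

Let D (e e' z : 'rV[R]_3) := \sum_i \sum_j e 0 i * e' 0 j * partial i (partial j F) z.

Let umbD z e e' : U z -> dot z z = 1 -> dot e z = 0 -> dot e' z = 0 ->
  dot e e = dot e' e' -> D e e z = D e' e' z.
Proof.
by move=> Uz z1 ez e'z ee'; rewrite /D -!(derive2_coord _ _ oU sF Uz); apply: umb.
Qed.

Let pF_diff i z : U z -> differentiable (partial i F) z.
Proof. exact: smooth_differentiable (finite_frame_rV _) oU (smooth_derive _ sF). Qed.

Let F_diff z : U z -> differentiable F z.
Proof. exact: smooth_differentiable (finite_frame_rV _) oU sF. Qed.

Let D_mixed z e e' : U z -> dot z z = 1 -> dot e z = 0 -> dot e' z = 0 ->
  dot e e = 1 -> dot e' e' = 1 -> dot e e' = 0 -> D e e' z = 0.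
Proof.
move=> Uz z1 ez e'z e1 e'1 ee'.
have P1 : dot (e + e') z = 0 by rewrite dotDl ez e'z addr0.
have P2 : dot (e - e') z = 0.
  by rewrite dotDl -scaleN1r dotZl ez e'z mulr0 addr0.
have P3 : dot (e + e') (e + e') = dot (e - e') (e - e').
  rewrite -scaleN1r !dotDl !dotDr !dotZl !dotZr (dotC e' e) ee'; ring.
have := umbD Uz z1 P1 P2 P3; rewrite /D => E.
apply: polarization.
  by move=> i j; exact: smooth_derive_comm oU sF Uz.
move: E; congr (_ = _); apply: eq_bigr => i _; apply: eq_bigr => j _;
  by rewrite !mxE.
Qed.

(** In the flat metric of the chart the trace-free Hessian is conformally
    covariant once the function is divided by the conformal factor. Thus a
    function with pure trace spherical Hessian becomes a function [g] of the
    plane with [g_ab = 0] and [g_aa = g_bb]. *)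
Definition chart_fun a b := (cfac a b)^-1 * F (stereo a b).

Definition chart_D1 a b := a * F (stereo a b)
  + (1 - a ^+ 2 * cfac a b) * partial ord0 F (stereo a b)
  + (- a * b * cfac a b) * partial o1 F (stereo a b)
  + (a * cfac a b) * partial o2 F (stereo a b).

Definition chart_D2 a b := b * F (stereo a b)
  + (- a * b * cfac a b) * partial ord0 F (stereo a b)
  + (1 - b ^+ 2 * cfac a b) * partial o1 F (stereo a b)
  + (b * cfac a b) * partial o2 F (stereo a b).

Lemma isD_chart_fun1 a b : U (stereo a b) ->
  isD a 1 (chart_fun^~ b) (chart_D1 a b).
Proof.
move=> Uc; have n0 : cfac a b != 0 by rewrite gt_eqF // cfac_gt0.
apply: isD_eq.
  apply: isD_mul; last exact: isD_stereo1 (F_diff Uc).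
  by apply: isD_inv; [exact: n0|exact: isD_cfac1].
rewrite /chart_D1; move: (F _) (partial _ _ _) (partial _ _ _) (partial _ _ _) n0.
by move: (cfac a b) => r ? ? ? ? n0; field.
Qed.

Lemma isD_chart_fun2 a b : U (stereo a b) ->
  isD b 1 (chart_fun a) (chart_D2 a b).
Proof.
move=> Uc; have n0 : cfac a b != 0 by rewrite gt_eqF // cfac_gt0.
apply: isD_eq.
  apply: isD_mul; last exact: isD_stereo2 (F_diff Uc).
  by apply: isD_inv; [exact: n0|exact: isD_cfac2].
rewrite /chart_D2; move: (F _) (partial _ _ _) (partial _ _ _) (partial _ _ _) n0.
by move: (cfac a b) => r ? ? ? ? n0; field.
Qed.

Let hessF a b i j := partial i (partial j F) (stereo a b).

Let hessF_sym a b : U (stereo a b) -> forall i j, hessF a b i j = hessF a b j i.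
Proof. by move=> Uc i j; exact: smooth_derive_comm oU sF Uc. Qed.

Let mixed0 a b : U (stereo a b) -> D (tan1 a b) (tan2 a b) (stereo a b) = 0.
Proof.
move=> Uc; exact: (D_mixed Uc (stereo_sphere a b) (tan1_stereo a b)
  (tan2_stereo a b) (tan11 a b) (tan22 a b) (tan12 a b)).
Qed.

Lemma isD_chart_D12 a b : U (stereo a b) -> isD b 1 (chart_D1 a) 0.
Proof.
move=> Uc; apply: (isD_chart_algebra12 (f := fun t => F (stereo a t))
  (q := fun i t => partial i F (stereo a t)) (hessF_sym Uc)).
- exact: isD_stereo2 (F_diff Uc).
- by move=> i; exact: isD_stereo2 (pF_diff i Uc).
- exact: mixed0.
Qed.

Lemma isD_chart_D21 a b : U (stereo a b) -> isD a 1 (chart_D2^~ b) 0.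
Proof.
move=> Uc; apply: (isD_chart_algebra21 (f := fun t => F (stereo t b))
  (q := fun i t => partial i F (stereo t b)) (hessF_sym Uc)).
- exact: isD_stereo1 (F_diff Uc).
- by move=> i; exact: isD_stereo1 (pF_diff i Uc).
- exact: mixed0.
Qed.

(** The common value of the two pure second derivatives. *)
Definition chart_trace a b := F (stereo a b)
  - a * cfac a b * partial ord0 F (stereo a b)
  - b * cfac a b * partial o1 F (stereo a b)
  + cfac a b * partial o2 F (stereo a b)
  + cfac a b * \sum_i \sum_j tan1 a b 0 i * tan1 a b 0 j
      * partial i (partial j F) (stereo a b).

Lemma isD_chart_D11 a b : U (stereo a b) -> isD a 1 (chart_D1^~ b) (chart_trace a b).
Proof.
move=> Uc; apply: (isD_chart_algebra11 (f := fun t => F (stereo t b))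
  (q := fun i t => partial i F (stereo t b)) (hessF_sym Uc)).
- exact: isD_stereo1 (F_diff Uc).
- by move=> i; exact: isD_stereo1 (pF_diff i Uc).
Qed.

Lemma isD_chart_D22 a b : U (stereo a b) -> isD b 1 (chart_D2 a) (chart_trace a b).
Proof.
move=> Uc; rewrite /chart_trace.
have := umbD Uc (stereo_sphere a b) (tan1_stereo a b) (tan2_stereo a b).
rewrite tan11 tan22 => /(_ erefl); rewrite /D => ->.
apply: (isD_chart_algebra22 (f := fun t => F (stereo a t))
  (q := fun i t => partial i F (stereo a t)) (hessF_sym Uc)).
- exact: isD_stereo2 (F_diff Uc).
- by move=> i; exact: isD_stereo2 (pF_diff i Uc).
Qed.
End LocalChart.
End Stereographic.

(** * Umbilic functions on the sphere are affine *)

Lemma isD_unique {R : realType} (V : normedModType R) (x v : V) (f : V -> R) a b :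
  isD x v f a -> isD x v f b -> a = b.
Proof. by move=> /isD_val <- /isD_val <-. Qed.

Lemma isD0_cst {R : realType} (f : R -> R) : (forall x : R, isD x 1 f 0) ->
  forall x y : R, f x = f y.
Proof. by move=> h x y; apply: is_derive_0_is_cst. Qed.

(** As the mixed derivative vanishes, [D1] depends on the first variable only
    and [D2] on the second only. Hence so do their derivatives, which are both
    equal to [K]; so [K] is constant. *)
Lemma quadratic_of_trace_hessian {R : realType} (g D1 D2 K : R -> R -> R) :
  (forall a b : R, isD a 1 (g^~ b) (D1 a b)) -> (forall a b : R, isD b 1 (g a) (D2 a b)) ->
  (forall a b : R, isD b 1 (D1 a) 0) -> (forall a b : R, isD a 1 (D2^~ b) 0) ->
  (forall a b : R, isD a 1 (D1^~ b) (K a b)) -> (forall a b : R, isD b 1 (D2 a) (K a b)) ->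
  exists k p q d, forall a b, g a b = k * (a ^+ 2 + b ^+ 2) + p * a + q * b + d.
Proof.
move=> g1 g2 D12 D21 D11 D22.
have E1 a b : D1 a b = D1 a 0 by apply: isD0_cst (D12 a) _ _.
have E2 a b : D2 a b = D2 0 b by apply: isD0_cst (D21^~ b) _ _.
have F1 b : D1^~ b = D1^~ 0 by apply/funext => a; rewrite E1.
have F2 a : D2 a = D2 0 by apply/funext => b; rewrite E2.
pose k := K 0 0.
have Kk a b : K a b = k.
  have h1 := D11 a b; rewrite F1 in h1.
  rewrite (isD_unique h1 (D11 a 0)).
  have h2 := D22 a 0; rewrite F2 in h2.
  exact: isD_unique h2 (D22 0 0).
have L1 a : D1 a 0 = k * a + D1 0 0.
  have H (x : R) : isD x 1 (fun a => D1 a 0 - k * a) 0.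
    apply: isD_eq.
      by apply: isD_sub; [exact: D11|apply: isD_mul; [exact: isD_cst|exact: isD_id]].
    by rewrite Kk /=; ring.
  have := isD0_cst H a 0; lra.
have L2 b : D2 0 b = k * b + D2 0 0.
  have H (x : R) : isD x 1 (fun b => D2 0 b - k * b) 0.
    apply: isD_eq.
      by apply: isD_sub; [exact: D22|apply: isD_mul; [exact: isD_cst|exact: isD_id]].
    by rewrite Kk /=; ring.
  have := isD0_cst H b 0; lra.
exists (k / 2), (D1 0 0), (D2 0 0), (g 0 0) => a b.
have S1 : g a b - (k / 2 * a ^+ 2 + D1 0 0 * a) = g 0 b.
  have H (x : R) : isD x 1 (fun a => g a b - (k / 2 * a ^+ 2 + D1 0 0 * a)) 0.
    apply: isD_eq.
      apply: isD_sub; first exact: g1.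
      apply: isD_add; apply: isD_mul; [exact: isD_cst| |exact: isD_cst|exact: isD_id].
      by apply: isD_sqr; exact: isD_id.
    by rewrite E1 L1 /=; field.
  have := isD0_cst H a 0 => /= ->; ring.
have S2 : g 0 b - (k / 2 * b ^+ 2 + D2 0 0 * b) = g 0 0.
  have H (x : R) : isD x 1 (fun b => g 0 b - (k / 2 * b ^+ 2 + D2 0 0 * b)) 0.
    apply: isD_eq.
      apply: isD_sub; first exact: g2.
      apply: isD_add; apply: isD_mul; [exact: isD_cst| |exact: isD_cst|exact: isD_id].
      by apply: isD_sqr; exact: isD_id.
    by rewrite L2 /=; field.
  have := isD0_cst H b 0 => /= ->; ring.
lra.
Qed.

Section UmbilicSphere.
Context {R : realType}.
Variable f : 'rV[R]_3 -> R.
Implicit Types a b t : R.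

(** [F] is a smooth extension, near a point of the sphere, of a function whose
    spherical Hessian is a multiple of the metric. *)
Definition umbilic_extension (U : set 'rV[R]_3) (F : 'rV[R]_3 -> R) :=
  [/\ open U, smooth U F, (forall z, U z -> dot z z = 1 -> F z = f z) &
   forall z e e', U z -> dot z z = 1 -> dot e z = 0 -> dot e' z = 0 ->
     dot e e = dot e' e' -> 'D_e ('D_e F) z = 'D_e' ('D_e' F) z].

Hypothesis fU : forall y, dot y y = 1 ->
  exists (U : set 'rV[R]_3) (F : 'rV[R]_3 -> R), U y /\ umbilic_extension U F.

Let g a b := (cfac a b)^-1 * f (stereo a b).
Let D1 a b := 'D_1 (g^~ b) a.
Let D2 a b := 'D_1 (g a) b.
Let K a b := 'D_1 (D1^~ b) a.

Let g_isD1 U F a b : umbilic_extension U F -> U (stereo a b) ->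
  isD a 1 (g^~ b) (chart_D1 F a b).
Proof.
move=> [oU sF FE umb] Uc; apply: isD_near (isD_chart_fun1 oU sF Uc).
apply: filterS (stereo_near1 oU Uc) => t Ut.
by rewrite /chart_fun /g FE // stereo_sphere.
Qed.

Let g_isD2 U F a b : umbilic_extension U F -> U (stereo a b) ->
  isD b 1 (g a) (chart_D2 F a b).
Proof.
move=> [oU sF FE umb] Uc; apply: isD_near (isD_chart_fun2 oU sF Uc).
apply: filterS (stereo_near2 oU Uc) => t Ut.
by rewrite /chart_fun /g FE // stereo_sphere.
Qed.

Let chart_hessian a b : [/\ isD a 1 (g^~ b) (D1 a b), isD b 1 (g a) (D2 a b),
  isD b 1 (D1 a) 0, isD a 1 (D2^~ b) 0 &
  isD a 1 (D1^~ b) (K a b) /\ isD b 1 (D2 a) (K a b)].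
Proof.
have [U [F [Uc uF]]] := fU (stereo_sphere a b).
have [oU sF FE umb] := uF.
have E1 a' b' : U (stereo a' b') -> chart_D1 F a' b' = D1 a' b'.
  by move=> Uc'; rewrite /D1 (isD_val (g_isD1 uF Uc')).
have E2 a' b' : U (stereo a' b') -> chart_D2 F a' b' = D2 a' b'.
  by move=> Uc'; rewrite /D2 (isD_val (g_isD2 uF Uc')).
have h11 : isD a 1 (D1^~ b) (chart_trace F a b).
  apply: isD_near (isD_chart_D11 oU sF Uc).
  by apply: filterS (stereo_near1 oU Uc) => t; exact: E1.
split.
- by rewrite -E1 //; exact: g_isD1 uF Uc.
- by rewrite -E2 //; exact: g_isD2 uF Uc.
- apply: isD_near (isD_chart_D12 oU sF umb Uc).
  by apply: filterS (stereo_near2 oU Uc) => t; exact: E1.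
- apply: isD_near (isD_chart_D21 oU sF umb Uc).
  by apply: filterS (stereo_near1 oU Uc) => t; exact: E2.
- rewrite /K (isD_val h11); split=> //.
  apply: isD_near (isD_chart_D22 oU sF umb Uc).
  by apply: filterS (stereo_near2 oU Uc) => t; exact: E2.
Qed.

(** In terms of the point [y] of the sphere, [cfac] is [1 - y_3] and
    [cfac * (a^2 + b^2)] is [1 + y_3]; so the quadratic polynomials produced by
    [quadratic_of_trace_hessian] become affine in [y]. *)
Lemma umbilic_affine_off_pole : exists (A : 'rV[R]_3) (B : R),
  forall y, dot y y = 1 -> y 0 o2 != 1 -> f y = dot A y + B.
Proof.
have [k [p [q [d gE]]]] : exists k p q d, forall a b,
    g a b = k * (a ^+ 2 + b ^+ 2) + p * a + q * b + d.
  by apply: (@quadratic_of_trace_hessian _ g D1 D2 K) => a b;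
     have [? ? ? ? []] := chart_hessian a b.
exists (vec3 p q (k - d)), (k + d) => y y1 yn.
have dn : 1 - y 0 o2 != 0 by rewrite subr_eq0 eq_sym.
pose a := y 0 ord0 / (1 - y 0 o2); pose b := y 0 o1 / (1 - y 0 o2).
have cE : cfac a b = 1 - y 0 o2.
  move: y1; rewrite /dot sum3 /cfac /a /b.
  move: (y 0 ord0) (y 0 o1) (y 0 o2) dn => u v w dn h.
  have den : 1 + (u / (1 - w)) ^+ 2 + (v / (1 - w)) ^+ 2 = 2 / (1 - w).
    have h' : u ^+ 2 + v ^+ 2 = 1 - w ^+ 2 by lra.
    transitivity (1 + (u ^+ 2 + v ^+ 2) / (1 - w) ^+ 2); first by field.
    by rewrite h'; field.
  by rewrite den invf_div mulrC divfK // pnatr_eq0.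
have yE : y = stereo a b.
  rewrite /stereo cE /a /b !divfK // subKr; exact: vec3_eta.
have := gE a b; rewrite /g -yE cE => h.
have -> : f y = (1 - y 0 o2) * ((1 - y 0 o2)^-1 * f y).
  by rewrite mulrA mulfV // mul1r.
rewrite h /dot sum3 !vec3E.
have rel := cfac_rel a b; rewrite cE in rel.
have ha : (1 - y 0 o2) * a = y 0 ord0 by rewrite mulrC divfK.
have hb : (1 - y 0 o2) * b = y 0 o1 by rewrite mulrC divfK.
rewrite -ha -hb.
move: (y 0 o2) rel => w rel.
transitivity (k * ((1 - w) * (1 + a ^+ 2 + b ^+ 2) - (1 - w)) + p * ((1 - w) * a)
   + q * ((1 - w) * b) + d * (1 - w)); first by ring.
by rewrite rel; ring.
Qed.

(** The pole of the projection is reached by continuity along a meridian. *)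
Lemma umbilic_affine : exists (A : 'rV[R]_3) (B : R),
  forall y, dot y y = 1 -> f y = dot A y + B.
Proof.
have [A [B fE]] := umbilic_affine_off_pole.
exists A, B => y y1; have [yn|] := eqVneq (y 0 o2) 1; last exact: fE.
have [U [F [Uy [oU sF FE _]]]] := fU y1.
(* the meridian [z] reaches the pole at [t = 0]; every other point is covered *)
pose z t := vec3 (t * cfac t 0) 0 (1 - t ^+ 2 * cfac t 0).
have z1 t : dot (z t) (z t) = 1.
  rewrite dot_vec3; have := cfac_rel t 0; move: (cfac t 0) => r rel.
  transitivity (1 + t ^+ 2 * r * (r * (1 + t ^+ 2 + 0 ^+ 2) - 2)); first by ring.
  by rewrite rel; ring.
have z0 : z 0 = y.
  move: y1; rewrite (vec3_eta y) dot_vec3 yn /z mul0r expr0n mul0r subr0.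
  move: (y 0 ord0) (y 0 o1) => a b h.
  have a0 : a = 0 by apply/eqP; rewrite -sqrf_eq0 -[_ == _]/(_ == 0); apply/eqP; nra.
  have b0 : b = 0 by apply/eqP; rewrite -sqrf_eq0; apply/eqP; nra.
  by rewrite a0 b0.
have cz : {for (0 : R), continuous z}.
  apply: (continuous_curve3 (a := fun t => t * cfac t 0) (b := fun=> 0)
    (c := fun t => 1 - t ^+ 2 * cfac t 0)).
  - by apply: isD_mul; [exact: isD_id|exact: isD_cfac1].
  - exact: isD_cst.
  - apply: isD_sub; first exact: isD_cst.
    by apply: isD_mul; [apply: isD_sqr; exact: isD_id|exact: isD_cfac1].
have Uz : \forall t \near (0 : R), U (z t).
  by apply: cz; apply: open_nbhs_nbhs; rewrite z0.
have cF : {for (0 : R), continuous (fun t => F (z t) - dot A (z t))}.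
  apply: continuousB.
    by apply: continuous_comp => //; rewrite z0; exact: smooth_continuous sF Uy.
  apply/differentiable_continuous/derivable1_diffP; apply: isD_derivable.
  rewrite (_ : (fun t => _) = fun t => A 0 ord0 * (t * cfac t 0) + A 0 o1 * 0
     + A 0 o2 * (1 - t ^+ 2 * cfac t 0)).
    apply: isD_add; last first.
      apply: isD_mul; first exact: isD_cst.
      apply: isD_sub; first exact: isD_cst.
      by apply: isD_mul; [apply: isD_sqr; exact: isD_id|exact: isD_cfac1].
    apply: isD_add; last exact: isD_cst.
    apply: isD_mul; first exact: isD_cst.
    by apply: isD_mul; [exact: isD_id|exact: isD_cfac1].
  by apply/funext => t; rewrite /dot sum3 !vec3E.
rewrite -(FE _ Uy y1) -z0; apply/eqP; rewrite eq_sym -subr_eq0 -normr_le0.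
apply/ler_addgt0Pl => e e0; rewrite addr0.
have [d d0 dP] := (continuous_forP _ _).1 cF e e0.
have [d' /= d'0 d'P] := (nbhs_normP _ _).1 Uz.
pose t := Num.min d d' / 2.
have m0 : 0 < Num.min d d' by rewrite lt_min d0.
have t0 : 0 < t by rewrite divr_gt0.
have : t < Num.min d d' by rewrite ltr_pdivrMr // ltr_pMr // ltr1n.
rewrite lt_min => /andP[td td'].
have := dP t; rewrite subr0 gtr0_norm // => /(_ td) h.
have Ut : U (z t) by apply: d'P; rewrite /= sub0r normrN gtr0_norm.
have zt : z t 0 o2 != 1.
  rewrite vec3E -subr_eq0 addrAC subrr sub0r oppr_eq0.
  by rewrite mulf_neq0 // gt_eqF // ?cfac_gt0 // exprn_gt0.
move: h; rewrite (FE _ Ut (z1 t)) (fE _ (z1 t) zt).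
move: (F (z 0)) (dot A (z 0)) (dot A (z t)) => u v w.
by rewrite (_ : w + B - w - (u - v) = v + B - u) => [/ltW //|]; ring.
Qed.
End UmbilicSphere.

(** * The asymptotic cone of the graph *)

Section Restriction.
Context {R : realType} {V : normedModType R}.

Let quotient_slice (F : V * R -> R) e z :
  (fun h : R => h^-1 *: (F (h *: e + z, 0) - F (z, 0))) =
  (fun h : R => h^-1 *: (F (h *: (e, 0) + (z, 0)) - F (z, 0))).
Proof.
apply/funext => h; congr (_ *: (F _ - _)).
by apply: injective_projections; rewrite /= ?scaler0 ?addr0.
Qed.

Lemma derive_restrict (F : V * R -> R) e :
  'D_e (fun z : V => F (z, 0)) = fun z => 'D_(e, 0) F (z, 0).
Proof. by apply/funext => z; rewrite /derive /= quotient_slice. Qed.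

Lemma derive2_restrict (F : V * R -> R) e z :
  'D_e ('D_e (fun z : V => F (z, 0))) z = 'D_(e, 0) ('D_(e, 0) F) (z, 0).
Proof.
have E := derive_restrict ('D_(e, 0) F) e.
rewrite -[RHS]/((fun z => 'D_(e, 0) ('D_(e, 0) F) (z, 0)) z) -E.
by rewrite (derive_restrict F e).
Qed.

Lemma derivable_restrict (F : V * R -> R) e z :
  derivable F (z, 0) (e, 0) -> derivable (fun z : V => F (z, 0)) z e.
Proof. by rewrite /derivable /= quotient_slice. Qed.

Lemma continuous_slice (z : V) : {for z, continuous (fun z : V => (z, 0 : R))}.
Proof. by apply/differentiable_continuous/differentiable_pair. Qed.

Lemma continuous_restrict (F : V * R -> R) (z : V) :
  {for (z, 0), continuous F} -> {for z, continuous (fun z : V => F (z, 0))}.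
Proof.
move=> cF.
have : {for z, continuous (F \o (fun z : V => (z, 0 : R)))}.
  by apply: continuous_comp; [exact: continuous_slice|exact: cF].
by [].
Qed.

Lemma open_slice (U : set (V * R)) : open U -> open [set z | U (z, 0)].
Proof. by move=> oU; apply: open_comp oU => z _; exact: continuous_slice. Qed.

Lemma smooth_slice (U : set (V * R)) (F : V * R -> R) : smooth U F ->
  smooth [set z | U (z, 0)] (fun z => F (z, 0)).
Proof.
move=> sF k; elim: k F sF => [|k IH] F sF; split=> //.
- by move=> z Uz; exact: continuous_restrict (smooth_continuous sF Uz).
- by move=> z Uz; exact: continuous_restrict (smooth_continuous sF Uz).
- move=> e; split; last by rewrite derive_restrict; apply: (IH ('D_(e, 0) F)); apply: smooth_derive.
  by move=> z Uz; apply: derivable_restrict; exact: smooth_derivable sF Uz.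
Qed.
End Restriction.

Lemma nbhs_normB {R : realType} (V : normedModType R) (p : V) (m : R) :
  0 < m -> nbhs p [set z | `|z - p| < m].
Proof. by move=> m0; apply/nbhs_normP; exists m => // z /=; rewrite distrC. Qed.

Lemma norm_pair_lt {R : realType} (V : normedModType R) (z y : V) (t m : R) :
  `|z - y| < m -> `|t| < m -> `|(z, t) - (y, 0)| < m.
Proof. by move=> zy tm; rewrite prod_normE /= subr0 gt_max zy tm. Qed.

Section Sphere.
Context {R : realType}.

Lemma continuous_dot_self : continuous (fun y : 'rV[R]_3 => dot y y).
Proof.
move=> y; have E : (fun y : 'rV[R]_3 => dot y y) =
    (fun y => y 0 ord0 * y 0 ord0 + y 0 o1 * y 0 o1 + y 0 o2 * y 0 o2).
  by apply/funext => z; rewrite /dot sum3.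
rewrite E.
have c i : {for y, continuous (fun y : 'rV[R]_3 => (y 0 i : R))} by exact: coord_continuous.
have cM i : {for y, continuous (fun y : 'rV[R]_3 => (y 0 i : R) * y 0 i)}.
  exact: continuousM (c i) (c i).
exact: continuousD (continuousD (cM _) (cM _)) (cM _).
Qed.

Lemma norm_le_dot (y : 'rV[R]_3) : `|y| <= Num.sqrt (dot y y).
Proof.
rewrite [leLHS]/Num.Def.normr/= mx_normrE; apply: bigmax_le; first exact: sqrtr_ge0.
move=> [i j] _ /=; rewrite ord1 -sqrtr_sqr ler_wsqrtr // dot_sqr (bigD1 j) //=.
by rewrite lerDl; apply: sumr_ge0 => k _; apply: sqr_ge0.
Qed.

Lemma compact_dot_le (r : R) : compact [set y : 'rV[R]_3 | dot y y <= r].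
Proof.
apply: bounded_closed_compact.
  exists (Num.sqrt r); split=> [|M rM y /= yr]; first exact: num_real.
  by rewrite (le_trans (norm_le_dot y)) // (le_trans (ler_wsqrtr yr)) // ltW.
apply: (@preimage_closed _ _ (fun y : 'rV[R]_3 => dot y y) [set x : R | x <= r]).
  by move=> y _; exact: continuous_dot_self.
exact: closed_le.
Qed.

Lemma compact_sphere : compact [set y : 'rV[R]_3 | dot y y = 1].
Proof.
apply: (@subclosed_compact _ _ [set y : 'rV[R]_3 | dot y y <= 1]).
- apply: (@preimage_closed _ _ (fun y : 'rV[R]_3 => dot y y) [set x : R | x = 1]).
    by move=> y _; exact: continuous_dot_self.
  exact: closed_eq.
- exact: compact_dot_le.
- by move=> y /= ->.
Qed.
End Sphere.

Section AsymptoticCone.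
Context {R : realType}.
Variable u : 'rV[R]_3 -> R.
Hypothesis su : smooth setT u.
Hypothesis sl : spacelike u.
Hypothesis cmc : forall x, mean_curvature u x = 1.
Hypothesis hS : bigO_s (fun x => `|scalar_curvature (induced_metric u) x + 6|) 4.
Hypothesis hP : smooth_up_to_infinity (P u).

(** The pointwise limit [G (y, 0)] is affine by [umbilic_affine]; compactness
    of the sphere makes the convergence uniform in the direction. *)
Lemma asymptotic_affine : exists (A : 'rV[R]_3) (B : R), forall e : R, 0 < e ->
  exists2 rho : R, 0 < rho & forall x, rho < enorm x ->
    `|P u x - (dot A x / enorm x + B)| < e.
Proof.
have [s0 s0_gt0 [G [sG GE]]] := hP.
have GPE y s : dot y y = 1 -> 0 < s <= s0 -> G (y, s) = P u (s^-1 *: y).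
  move=> y1 /andP[s_gt0 s_le]; rewrite GE //; split=> /=; first exact: enorm_eq1.
  by rewrite in_itv /= s_gt0.
have loc y : dot y y = 1 -> exists (U : set ('rV[R]_3 * R)) (F : 'rV[R]_3 * R -> R),
    [/\ open U, U (y, 0), smooth U F & forall z s, dot z z = 1 -> 0 <= s <= s0 ->
      U (z, s) -> F (z, s) = G (z, s)].
  move=> y1; have [|U [F [oU Uy sF FE]]] := sG (y, 0).
    split=> /=; first exact: enorm_eq1.
    by rewrite in_itv /= lexx ltW.
  exists U, F; split=> // z s z1 s01 Uz; apply: FE; split=> //.
  by split=> /=; [exact: enorm_eq1|rewrite in_itv].
have [A [B GA]] : exists (A : 'rV[R]_3) (B : R),
    forall y, dot y y = 1 -> G (y, 0) = dot A y + B.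
  apply: (@umbilic_affine _ (fun y => G (y, 0))) => y y1.
  have [U [F [oU Uy sF FE]]] := loc y y1.
  exists [set z | U (z, 0)], (fun z => F (z, 0)); split; first exact: Uy.
  split.
  - exact: open_slice.
  - exact: smooth_slice.
  - by move=> z Uz z1; apply: FE; [exact: z1|rewrite lexx ltW|exact: Uz].
  - move=> z e e' Uz z1 ez e'z ee'.
    have FEu y' s : dot y' y' = 1 -> 0 < s <= s0 -> U (y', s) ->
        F (y', s) = s^-1 - u (s^-1 *: y').
      move=> y'1 /andP[s_gt0 s_le] Uys.
      rewrite FE ?(ltW s_gt0) // GPE ?s_gt0 // /P enormZ ?invr_ge0 ?(ltW s_gt0) //.
      by rewrite (enorm_eq1 y'1) mulr1.
    rewrite !derive2_restrict.
    exact: (umbilic_at_infinity su sl cmc hS s0_gt0 oU sF FEu z1 Uz ez e'z ee').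
exists A, B => e e0.
have /compact_near_coveringP cov := @compact_sphere R.
have := cov R (nbhs (0 : R)) (fun s y => dot y y = 1 -> 0 < s ->
  `|G (y, s) - G (y, 0)| < e) _.
case.
  move=> y y1.
  have [U [F [oU Uy sF FE]]] := loc y y1.
  have e2 : 0 < e / 2 by rewrite divr_gt0.
  have [d d0 dP] := (continuous_forP _ _).1 (smooth_continuous sF Uy) _ e2.
  have [d' d'0 d'P] := open_normP oU Uy.
  (* near [(y, 0)], compare both values of [F] with [F (y, 0)] *)
  pose m := Num.min (Num.min d d') s0.
  have m0 : 0 < m by rewrite !lt_min d0 d'0.
  exists ([set z | `|z - y| < m], [set s | `|s - 0| < m]).
    by split; exact: nbhs_normB.
  move=> [z s] [/= zy]; rewrite subr0 => sm z1 s_gt0.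
  have s_lt : s < m by rewrite (le_lt_trans (ler_norm _)).
  have N1 := norm_pair_lt zy sm.
  have N2 := norm_pair_lt zy (eq_ind_r (fun c => c < m) m0 (normr0 R)).
  have s_s0 : s <= s0 by move: s_lt; rewrite !lt_min => /andP[_ /ltW].
  move: N1 N2; rewrite !lt_min => /andP[/andP[a1 a2] _] /andP[/andP[b1 b2] _].
  rewrite -(FE z s) ?(ltW s_gt0) //; last exact: d'P.
  rewrite -(FE z 0) ?lexx ?(ltW s0_gt0) //; last exact: d'P.
  have := dP _ a1; have := dP _ b1.
  move: (F (z, s)) (F (z, 0)) (F (y, 0)) => f1 f2 f3 h2 h1.
  rewrite (_ : f1 - f2 = (f1 - f3) - (f2 - f3)); last by ring.
  by rewrite (le_lt_trans (ler_normB _ _)) // (splitr e) ltrD.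
move=> d /= d0 dP.
pose m := Num.min d s0; have m0 : 0 < m by rewrite lt_min d0.
exists m^-1; first by rewrite invr_gt0.
move=> x xm; have x0 : 0 < enorm x by rewrite (lt_trans _ xm) // invr_gt0.
pose s := (enorm x)^-1; have s_gt0 : 0 < s by rewrite invr_gt0.
have sm : s < m by rewrite /s invf_plt ?posrE.
have [sd ss0] : s < d /\ s < s0 by move: sm; rewrite lt_min => /andP[].
have y1 : dot (s *: x) (s *: x) = 1.
  rewrite dotZl dotZr -enorm_sqr /s; move: (enorm x) x0 => n n0.
  by field; rewrite gt_eqF.
have := dP s _ (s *: x) y1 y1 s_gt0.
rewrite /= distrC subr0 gtr0_norm // => /(_ sd).
rewrite GPE ?s_gt0 ?(ltW ss0) // GA // scalerA mulVf ?gt_eqF // scale1r.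
by rewrite dotZr mulrC.
Qed.
End AsymptoticCone.

(** * Comparison with hyperboloids *)

Section SecondDerivativeTest.
Context {R : realType}.
Implicit Types (f g : R -> R) (t : R).

Lemma isD_cvg f (df x : R) : isD x 1 f df ->
  (fun h : R => h^-1 *: (f (h + x) - f x)) @ 0^' --> df.
Proof.
move=> [d <-]; move: d; rewrite /derivable /derive /=.
have -> : (fun h : R => h^-1 *: (f (h *: 1 + x) - f x)) =
          (fun h : R => h^-1 *: (f (h + x) - f x)).
  by apply/funext => h; rewrite [h *: 1]mulr1.
exact.
Qed.

Lemma second_derivative_test f (f1 : R -> R) (f2 : R) :
  (forall t, isD t 1 f (f1 t)) -> isD (0 : R) 1 f1 f2 ->
  (forall t, f t <= f 0) -> f1 0 = 0 /\ f2 <= 0.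
Proof.
move=> df df1 fmax.
have f10 : f1 0 = 0.
  have h : isD (0 : R) 1 f 0.
    apply: (@derive1_at_max R f (-1) 1 0); first lra.
    - by move=> t _; exact: isD_derivable (df t).
    - by rewrite in_itv /= ltrN10 ltr01.
    - by move=> t _; exact: fmax.
  by rewrite -(isD_val (df 0)) (isD_val h).
(* otherwise [f1] is positive just to the right of 0, where [f] increases *)
split=> //; rewrite leNgt; apply/negP => f2pos.
have /cvgrPdist_lt/(_ _ f2pos) := isD_cvg df1.
rewrite near_withinE => /nbhs_normP[d /= d0 dP].
pose t := d / 2; have t0 : 0 < t by rewrite divr_gt0.
have td : t < d by rewrite ltr_pdivrMr // ltr_pMr // ltr1n.
have f1pos s : 0 < s <= t -> 0 < f1 s.
  move=> /andP[s0 st].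
  have := dP s; rewrite /= sub0r normrN gtr0_norm // => /(_ (le_lt_trans st td)).
  rewrite gt_eqF // => /(_ isT); rewrite addr0 f10 subr0 => h.
  have : 0 < s^-1 * f1 s.
    have : f2 - s^-1 * f1 s < f2 := le_lt_trans (ler_norm _) h.
    by rewrite ltrBlDr ltrDl.
  by rewrite pmulr_rgt0 // invr_gt0.
have cf : {within `[0, t], continuous f}.
  by apply: derivable_within_continuous => s _; exact: isD_derivable (df s).
have [c cI E] := @MVT R f f1 0 t t0 (fun s _ => df s) cf.
move: cI; rewrite in_itv /= => /andP[c0 ct].
have := fmax t; rewrite -subr_le0 E subr0 leNgt => /negP; apply.
by rewrite mulr_gt0 // f1pos // c0 ltW.
Qed.
End SecondDerivativeTest.

Section Hyperboloid.
Context {R : realType}.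
Implicit Types (l c : R) (x e a : 'rV[R]_3).

(** The upper sheet of the Lorentzian sphere of radius [l] about the point
    [(- a, 0)]; its mean curvature is [l^-1]. *)
Definition hyperboloid l a x := Num.sqrt (l ^+ 2 + dot (x + a) (x + a)).

Lemma hyperboloid_gt0 l a x : 0 < l -> 0 < hyperboloid l a x.
Proof. by move=> l0; rewrite sqrtr_gt0 ltr_pwDl ?exprn_gt0 // dot_ge0. Qed.

Lemma hyperboloid_sqr l a x :
  hyperboloid l a x ^+ 2 = l ^+ 2 + dot (x + a) (x + a).
Proof. by rewrite sqr_sqrtr // addr_ge0 ?sqr_ge0 ?dot_ge0. Qed.

Lemma isD_hyperboloid_line l a x e (t : R) : 0 < l ->
  isD t 1 (fun s : R => hyperboloid l a (x + s *: e))
    ((dot (x + a) e + t * dot e e) / hyperboloid l a (x + t *: e)).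
Proof.
move=> l0.
have E s : dot (x + s *: e + a) (x + s *: e + a) =
    dot (x + a) (x + a) + (2 * dot (x + a) e * s + dot e e * s ^+ 2).
  rewrite addrAC !dotDl !dotDr !dotZl !dotZr (dotC e x) (dotC e a) (dotC a x).
  by rewrite (dotC a e); ring.
have H : (fun s : R => hyperboloid l a (x + s *: e)) = fun s =>
    Num.sqrt (l ^+ 2 + (dot (x + a) (x + a) + (2 * dot (x + a) e * s + dot e e * s ^+ 2))).
  by apply/funext => s; rewrite /hyperboloid E.
rewrite H; apply: isD_eq.
  apply: isD_sqrt; first by rewrite -E ltr_pwDl ?exprn_gt0 // dot_ge0.
  apply: isD_add; first exact: isD_cst.
  apply: isD_add; first exact: isD_cst.
  apply: isD_add; apply: isD_mul; [exact: isD_cst|exact: isD_id|exact: isD_cst|].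
  by apply: isD_sqr; exact: isD_id.
cbv beta; rewrite -E -/(hyperboloid l a (x + t *: e)) invfM.
move: (hyperboloid l a (x + t *: e))^-1 => i /=.
by field.
Qed.

Lemma isD2_hyperboloid_line l a x e : 0 < l ->
  isD (0 : R) 1
   (fun t : R => (dot (x + a) e + t * dot e e) / hyperboloid l a (x + t *: e))
   ((dot e e - (dot (x + a) e / hyperboloid l a x) ^+ 2) / hyperboloid l a x).
Proof.
move=> l0; have q0 := hyperboloid_gt0 a x l0.
apply: isD_eq.
  apply: isD_mul.
    apply: isD_add; first exact: isD_cst.
    by apply: isD_mul; [exact: isD_id|exact: isD_cst].
  apply: isD_inv; last exact: isD_hyperboloid_line.
  by rewrite gt_eqF // hyperboloid_gt0.
rewrite /= scale0r addr0; move: (hyperboloid l a x) q0 => q q0.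
by field; rewrite gt_eqF.
Qed.

Lemma hyperboloid_continuous l a : continuous (hyperboloid l a).
Proof.
move=> x; apply: (@continuous_comp _ _ _ (fun x => l ^+ 2 + dot (x + a) (x + a)) Num.sqrt);
  last exact: sqrt_continuous.
apply: continuousD; first exact: cst_continuous.
apply: (@continuous_comp _ _ _ (fun x => x + a) (fun y => dot y y));
  last exact: continuous_dot_self.
by apply: continuousD; [exact: cvg_id|exact: cst_continuous].
Qed.

(** Lets the comparison with radii different from 1 pass to the limit. *)
Lemma hyperboloid_le_shift l m a x : 0 < l -> l <= m ->
  hyperboloid m a x <= hyperboloid l a x + (m - l).
Proof.
move=> l0 lm; have q0 := hyperboloid_gt0 a x l0.
have m0 : 0 < m by exact: lt_le_trans lm.
have lq : l <= hyperboloid l a x.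
  by rewrite -[leLHS](gtr0_norm l0) -sqrtr_sqr ler_wsqrtr // lerDl dot_ge0.
have h1 := hyperboloid_sqr l a x; have h2 := hyperboloid_sqr m a x.
have p0 := hyperboloid_gt0 a x m0.
move: (hyperboloid l a x) (hyperboloid m a x) (dot _ _) q0 lq h1 h2 p0.
move=> q p d q0 lq h1 h2 p0; rewrite leNgt; apply/negP => h.
have k0 : 0 < q + (m - l) by lra.
have : (q + (m - l)) ^+ 2 < p ^+ 2 by rewrite ltrXn2r // ?nnegrE ltW.
rewrite h2 sqrrD h1; nra.
Qed.

Lemma asymptotic_algebra (q n d M A : R) : 0 <= q -> 0 < n -> 2 * A <= n ->
  0 <= A -> d ^+ 2 <= A ^+ 2 * n ^+ 2 -> 0 <= M ->
  q ^+ 2 = M + n ^+ 2 + 2 * d + A ^+ 2 ->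
  `|q - (n + d / n)| <= 2 * (M + A ^+ 2) / n.
Proof.
move=> q0 n0 nA A0 hd M0 hq.
have nn : n != 0 by rewrite gt_eqF.
pose k := d / n; have dk : d = k * n by rewrite divfK.
have kA2 : k ^+ 2 <= A ^+ 2.
  by move: hd; rewrite dk exprMn ler_pM2r // exprn_gt0.
have kA : - A <= k.
  have : `|k| <= `|A| by rewrite -sqrtr_sqr -[leRHS]sqrtr_sqr ler_wsqrtr.
  by rewrite [X in _ <= X]ger0_norm // ler_norml => /andP[].
rewrite -/k ler_pdivlMr //.
have E : (q - (n + k)) * (q + (n + k)) = M + A ^+ 2 - k ^+ 2.
  transitivity (q ^+ 2 - n ^+ 2 - 2 * (k * n) - k ^+ 2); first by ring.
  by rewrite hq -dk; ring.
have s0 : n / 2 <= q + (n + k) by lra.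
have : `|q - (n + k)| * (q + (n + k)) <= M + A ^+ 2.
  have s1 : 0 <= q + (n + k) by lra.
  rewrite -[X in _ * X](ger0_norm s1) -normrM E ger0_norm; last by lra.
  by rewrite gerDl oppr_le0 sqr_ge0.
move: (normr_ge0 (q - (n + k))).
move: (`|q - (n + k)|) (q + (n + k)) s0 => z y s0 z0 h.
have : z * (n / 2) <= z * y by rewrite ler_wpM2l.
lra.
Qed.

Lemma dot_sqr_le (v w : 'rV[R]_3) : dot v w ^+ 2 <= dot v v * dot w w.
Proof. by rewrite !dot_sqr; apply: cauchy_schwarz3. Qed.

(** The asymptotics do not depend on the radius [l]: this leaves room for the
    strict inequality that the maximum principle needs. *)
Lemma hyperboloid_asymptotic l a (e : R) : 0 < e ->
  exists2 rho : R, 0 < rho & forall x, rho < enorm x ->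
    `|hyperboloid l a x - (enorm x + dot a x / enorm x)| < e.
Proof.
move=> e0; pose M := l ^+ 2; pose A := enorm a.
have A0 : 0 <= A by rewrite /A enormE sqrtr_ge0.
pose N := M + A ^+ 2.
have N0 : 0 <= N by rewrite addr_ge0 // sqr_ge0.
exists (2 * A + (2 * N / e + 1)).
  by rewrite ltr_wpDl ?mulr_ge0 // ltr_wpDl // divr_ge0 ?(ltW e0) // mulr_ge0.
have h1 : 0 <= 2 * N / e by rewrite divr_ge0 ?(ltW e0) // mulr_ge0.
move=> x xr; have x0 : 0 < enorm x.
  by apply: le_lt_trans xr; rewrite addr_ge0 ?mulr_ge0 // addr_ge0.
have x2A : 2 * A <= enorm x by lra.
have xN : 2 * N / e < enorm x by lra.
apply: (@le_lt_trans _ _ (2 * (M + A ^+ 2) / enorm x)).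
  apply: asymptotic_algebra => //.
  - by rewrite /hyperboloid sqrtr_ge0.
  - by rewrite !enorm_sqr dot_sqr_le.
  - by rewrite /M sqr_ge0.
  - rewrite hyperboloid_sqr !enorm_sqr !dotDl !dotDr (dotC x a) -/M.
    move: (dot x x) (dot a x) (dot a a) => *; ring.
by move: xN; rewrite -/N !ltr_pdivrMr // [e * _]mulrC.
Qed.
End Hyperboloid.

Section Comparison.
Context {R : realType}.
Variable u : 'rV[R]_3 -> R.
Hypothesis su : smooth setT u.
Hypothesis sl : spacelike u.
Hypothesis cmc : forall x, mean_curvature u x = 1.
Implicit Types (l b sigma : R) (a x e : 'rV[R]_3).

Lemma dot_basis x i : dot x (basis_vec i) = x 0 i.
Proof.
rewrite /dot (bigD1 i) //= mxE !eqxx mulr1 big1 ?addr0 // => j /negbTE ij.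
by rewrite mxE ij andbF mulr0.
Qed.

Lemma mean_curvature_dirE x :
  mean_curvature u x = 3^-1 * ((Num.sqrt (slack u x))^-1 *
    (\sum_k 'D_(basis_vec k) ('D_(basis_vec k) u) x
     + (slack u x)^-1 * 'D_(gradient u x) ('D_(gradient u x) u) x)).
Proof.
rewrite (mean_curvatureE su sl); congr (_ * (_ * (_ + _ * _))).
rewrite (derive_dir2E su); apply: eq_bigr => i _.
rewrite mxE; congr (_ * _); apply: eq_bigr => j _.
by rewrite mxE mulrC.
Qed.

Lemma touching_test l a sigma x0 : 0 < l -> sigma != 0 ->
  (forall x, sigma * (u x - hyperboloid l a x)
             <= sigma * (u x0 - hyperboloid l a x0)) ->
  forall e, 'D_e u x0 = dot (x0 + a) e / hyperboloid l a x0 /\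
   sigma * 'D_e ('D_e u) x0 <= sigma *
     ((dot e e - (dot (x0 + a) e / hyperboloid l a x0) ^+ 2) / hyperboloid l a x0).
Proof.
move=> l0 sn max e.
have du x : differentiable u x := u_differentiable su x.
have ddu x : differentiable ('D_e u) x.
  exact: smooth_differentiable (finite_frame_rV _) openT (smooth_derive e su) I.
have hu (t : R) : isD t 1 (fun s : R => u (x0 + s *: e)) ('D_e u (x0 + t *: e)).
  by apply: is_derive_line; apply: diff_derivable.
have hu2 : isD (0 : R) 1 (fun s : R => 'D_e u (x0 + s *: e)) ('D_e ('D_e u) x0).
  have -> : 'D_e ('D_e u) x0 = 'D_e ('D_e u) (x0 + 0 *: e) by rewrite scale0r addr0.
  by apply: is_derive_line; apply: diff_derivable.
pose f (s : R) := sigma * (u (x0 + s *: e) - hyperboloid l a (x0 + s *: e)).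
pose f1 (s : R) := sigma * ('D_e u (x0 + s *: e)
  - (dot (x0 + a) e + s * dot e e) / hyperboloid l a (x0 + s *: e)).
have df (t : R) : isD t 1 f (f1 t).
  apply: isD_eq.
    apply: isD_mul; first exact: isD_cst.
    by apply: isD_sub; [exact: hu|exact: isD_hyperboloid_line].
  by rewrite mulr0 addr0.
have df1 : isD (0 : R) 1 f1 (sigma * ('D_e ('D_e u) x0 -
   (dot e e - (dot (x0 + a) e / hyperboloid l a x0) ^+ 2) / hyperboloid l a x0)).
  apply: isD_eq.
    apply: isD_mul; first exact: isD_cst.
    by apply: isD_sub; [exact: hu2|exact: isD2_hyperboloid_line].
  by rewrite mulr0 addr0.
have fmax t : f t <= f 0 by rewrite /f scale0r addr0; exact: max.
have [f10 f2] := second_derivative_test df df1 fmax.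
split; last by rewrite -subr_le0 -mulrBr.
move: f10; rewrite /f1 scale0r addr0 mul0r addr0 => /eqP.
by rewrite mulf_eq0 (negbTE sn) /= subr_eq0 => /eqP.
Qed.

(** At an extremum of [u - hyperboloid] the gradients agree and the Hessians
    are ordered, hence so are the mean curvatures, 1 and [l^-1]. The sign
    [sigma] treats maxima and minima together. *)
Lemma touching_radius l a sigma x0 : 0 < l -> sigma != 0 ->
  (forall x, sigma * (u x - hyperboloid l a x)
             <= sigma * (u x0 - hyperboloid l a x0)) ->
  sigma * l <= sigma.
Proof.
move=> l0 sn max; have T := touching_test l0 sn max.
have q0 := hyperboloid_gt0 a x0 l0.
have qE := hyperboloid_sqr l a x0.
pose q := hyperboloid l a x0; pose X := x0 + a.
have pE i : partial i u x0 = X 0 i / q.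
  by have [] := T (basis_vec i); rewrite dot_basis.
have gE : gradient u x0 = q^-1 *: X.
  by apply/rowP => i; rewrite !mxE pE /X mxE mulrC.
have qn : q != 0 by rewrite gt_eqF.
have XX : dot X X = q ^+ 2 - l ^+ 2 by rewrite qE addrC addKr.
have ln : l != 0 by rewrite gt_eqF.
have WE : slack u x0 = (l / q) ^+ 2.
  rewrite /slack /grad2.
  have -> : \sum_i partial i u x0 ^+ 2 = dot X X / q ^+ 2.
    rewrite dot_sqr mulr_suml; apply: eq_bigr => i _.
    by rewrite pE expr_div_n.
  by rewrite XX; field.
have lq0 : 0 < l / q by rewrite divr_gt0.
have := cmc x0; rewrite mean_curvature_dirE WE sqrtr_sqr gtr0_norm // => E.
have [_ hp] := T (gradient u x0).
have hk k := (T (basis_vec k)).2.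
(* the mean curvature is a positive combination of second derivatives in the
   coordinate directions and in the direction of the gradient *)
have hs : sigma * \sum_k 'D_(basis_vec k) ('D_(basis_vec k) u) x0 <=
    sigma * ((3 - dot X X / q ^+ 2) / q).
  rewrite mulr_sumr; apply: le_trans (ler_sum _ (fun k _ => hk k)) _.
  rewrite -mulr_sumr -mulr_suml -/q -/X sumrB.
  have -> : \sum_(i < 3) dot (basis_vec i) (basis_vec i) = 3 :> R.
    rewrite (eq_bigr (fun=> 1)) => [|i _]; last by rewrite dot_basis mxE !eqxx.
    by rewrite sumr_const card_ord.
  have -> : \sum_(i < 3) (dot X (basis_vec i) / q) ^+ 2 = dot X X / q ^+ 2.
    rewrite dot_sqr mulr_suml; apply: eq_bigr => i _.
    by rewrite dot_basis expr_div_n.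
  by [].
move: hp; rewrite gE -/q -/X !dotZl !dotZr XX => hp.
rewrite gE in E; rewrite XX in hs.
move: E hp hs; rewrite -/q.
move: ('D_(q^-1 *: X) _ _) (\sum_k 'D_(basis_vec k) _ _) => B C E hp hs.
have hB : sigma * (((l / q) ^+ 2)^-1 * B) <= sigma * ((q ^+ 2 - l ^+ 2) / q ^+ 2 / q).
  rewrite mulrCA.
  have -> : sigma * ((q ^+ 2 - l ^+ 2) / q ^+ 2 / q) = ((l / q) ^+ 2)^-1 *
    (sigma * ((q^-1 * (q^-1 * (q ^+ 2 - l ^+ 2)) - (q^-1 * (q ^+ 2 - l ^+ 2) / q) ^+ 2) / q)).
    by field; rewrite qn ln.
  by rewrite ler_pM2l // invr_gt0 exprn_gt0.
have E3 : C + ((l / q) ^+ 2)^-1 * B = 3 * (l / q).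
  have -> : C + ((l / q) ^+ 2)^-1 * B = 3 * (l / q) *
      (3^-1 * ((l / q)^-1 * (C + ((l / q) ^+ 2)^-1 * B))).
    by field; rewrite qn ln.
  by rewrite E mulr1.
have : sigma * (3 * (l / q)) <= sigma * (3 / q).
  rewrite -E3 mulrDr (le_trans (lerD hs hB)) // -mulrDr le_eqVlt.
  by apply/orP; left; apply/eqP; congr (_ * _); field.
have -> : sigma * (3 * (l / q)) = (3 / q) * (sigma * l) by ring.
by rewrite [sigma * (3 / q)]mulrC ler_pM2l // divr_gt0.
Qed.

Definition asymptotic_to a b l := forall e : R, 0 < e ->
  exists2 rho : R, 0 < rho & forall x, rho < enorm x ->
    `|u x - (hyperboloid l a x + b)| < e.

(** If the difference were positive somewhere, it would attain a positive
    maximum because it vanishes at infinity, against [touching_radius]. *)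
Lemma one_sided_comparison a b l sigma : 0 < l -> `|sigma| = 1 ->
  sigma < sigma * l -> asymptotic_to a b l ->
  forall x, sigma * (u x - (hyperboloid l a x + b)) <= 0.
Proof.
move=> l0 s1 sl_lt asym x1; rewrite leNgt; apply/negP => pos.
have sn : sigma != 0 by rewrite -normr_eq0 s1 oner_eq0.
pose w x := sigma * (u x - (hyperboloid l a x + b)).
have wle x : w x <= `|u x - (hyperboloid l a x + b)|.
  by rewrite (le_trans (ler_norm _)) // normrM s1 mul1r.
have [rho rho0 far] := asym _ pos.
pose A := [set x : 'rV[R]_3 | dot x x <= rho ^+ 2].
have near x : ~ A x -> w x < w x1.
  move=> /negP; rewrite -ltNge -enorm_sqr => h.
  apply: le_lt_trans (wle x) (far x _).
  by rewrite -(@ltr_pXn2r _ 2) // nnegrE ?(ltW rho0) // enormE sqrtr_ge0.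
have Ax1 : A x1.
  by have [//|/near] := pselect (A x1); rewrite ltxx.
have cu x : {for x, continuous u}.
  by apply: differentiable_continuous; exact: u_differentiable.
have cw : continuous w.
  move=> x.
  have c1 : {for x, continuous (fun x => u x - (hyperboloid l a x + b))}.
    apply: continuousB; first exact: cu.
    by apply: continuousD; [exact: hyperboloid_continuous|exact: cst_continuous].
  exact: cvgM (cvg_cst sigma) c1.
have [x0 x0A xmax] : exists2 c, c \in A & forall t, t \in A -> w t <= w c.
  apply: compact_EVT_max; [by exists x1|exact: compact_dot_le|].
  exact: continuous_subspaceT.
have gmax x : w x <= w x0.
  have [/mem_set xA|/near h] := pselect (A x); first exact: xmax.
  by rewrite (le_trans (ltW h)) // xmax // mem_set.
have := @touching_radius l a sigma x0 l0 sn _; rewrite leNgt => h.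
apply: (negP (h _) sl_lt) => x.
have := gmax x; rewrite /w !opprD !addrA !mulrDr.
by rewrite lerD2r.
Qed.

(** Compare from above with radii slightly larger than 1 and from below with
    radii slightly smaller. *)
Lemma hyperboloid_unique a b : (forall l, 0 < l -> asymptotic_to a b l) ->
  forall x, u x = hyperboloid 1 a x + b.
Proof.
move=> asym x; apply/eqP; rewrite eq_le; apply/andP; split.
  apply/ler_addgt0Pr => e e0.
  have l0 : 0 < 1 + e by rewrite addr_gt0.
  have := @one_sided_comparison a b (1 + e) 1 l0 (normr1 _) _ (asym _ l0) x.
  rewrite !mul1r ltrDl subr_le0 => /(_ e0) h; apply: (le_trans h).
  have := @hyperboloid_le_shift _ 1 (1 + e) a x ltr01; rewrite lerDl => /(_ (ltW e0)).
  lra.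
apply/ler_addgt0Pr => e e0.
(* the bound [1 / 2] keeps the radius [1 - d] positive *)
pose d := Num.min e (1 / 2); have d0 : 0 < d by rewrite lt_min e0 divr_gt0.
have de : d <= e by rewrite ge_min lexx.
have d2 : d <= 1 / 2 by rewrite ge_min lexx orbT.
have l0 : 0 < 1 - d by lra.
have := @one_sided_comparison a b (1 - d) (-1) l0 _ _ (asym _ l0) x.
rewrite normrN1 !mulN1r ltrN2 gtrBl oppr_le0 subr_ge0 => /(_ erefl d0) h.
have := @hyperboloid_le_shift _ (1 - d) 1 a x l0; rewrite gerBl => /(_ (ltW d0)).
lra.
Qed.

Lemma u_hyperboloid : (exists (A : 'rV[R]_3) (B : R), forall e : R, 0 < e ->
  exists2 rho : R, 0 < rho & forall x, rho < enorm x ->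
    `|P u x - (dot A x / enorm x + B)| < e) ->
  exists a b, forall x, u x = hyperboloid 1 a x + b.
Proof.
move=> [A [B hA]]; exists (- A), (- B); apply: hyperboloid_unique => l l0 e e0.
have e2 : 0 < e / 2 by rewrite divr_gt0.
have [r1 r10 h1] := hA _ e2.
have [r2 r20 h2] := hyperboloid_asymptotic l (- A) e2.
exists (Num.max r1 r2); first by rewrite lt_max r10.
move=> x; rewrite gt_max => /andP[/h1 {}h1 /h2 {}h2].
have E : dot (- A) x = - dot A x by rewrite -scaleN1r dotZl mulN1r.
move: h1 h2; rewrite E /P mulNr.
move: (u x) (hyperboloid _ _ _) (enorm x) (dot A x / enorm x) => p q n k h1 h2.
rewrite (_ : p - (q - B) = - (n - p - (k + B)) - (q - (n - k))); last by ring.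
by rewrite (le_lt_trans (ler_normB _ _)) // normrN (splitr e) ltrD.
Qed.
End Comparison.

(** * Isometry with the ball model *)

Section ClassC.
Context {R : realType} {V : normedModType R}.
Variable U : set V.
Hypothesis oU : open U.
Implicit Types (f g : V -> R) (k : nat).

Let nearU x : U x -> \forall z \near x, U z.
Proof. by move=> Ux; apply: open_nbhs_nbhs. Qed.

Lemma continuous_ext (W : normedModType R) (f g : V -> W) x : U x -> (forall z, U z -> f z = g z) ->
  {for x, continuous f} -> {for x, continuous g}.
Proof.
move=> Ux fg /continuous_forP cf; apply/continuous_forP => e /cf[d d0 dP].
have [d' d'0 d'P] := open_normP oU Ux.
exists (Num.min d d'); first by rewrite lt_min d0.
by move=> z; rewrite lt_min => /andP[/dP h /d'P Uz]; rewrite -!fg.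
Qed.

Lemma class_C_ext (W : normedModType R) (f g : V -> W) k : (forall x, U x -> f x = g x) ->
  class_C U k f -> class_C U k g.
Proof.
elim: k f g => [|k IH] f g fg [cf Hf]; split.
- by move=> x Ux; apply: continuous_ext Ux fg (cf x Ux).
- by [].
- by move=> x Ux; apply: continuous_ext Ux fg (cf x Ux).
move=> v; have [df Df] := Hf v; split.
  move=> x Ux; apply: near_eq_derivable (df x Ux).
  by apply: filterS (nearU Ux) => z /fg.
apply: IH Df => x Ux; apply: near_eq_derive.
by apply: filterS (nearU Ux) => z /fg.
Qed.

Lemma class_CS (W : normedModType R) (f : V -> W) k : class_C U k.+1 f -> class_C U k f.
Proof.
elim: k f => [|k IH] f [cf Hf]; split=> // v; have [df Df] := Hf v.
by split=> //; exact: IH.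
Qed.

(** The induction step of all the closure properties below: a formula for the
    derivative, valid on [U] only, suffices. *)
Lemma class_C_derive (f : V -> R) k :
  (forall x, U x -> {for x, continuous f}) ->
  (forall v, exists2 g, class_C U k g & forall x, U x -> isD x v f (g x)) ->
  class_C U k.+1 f.
Proof.
move=> cf H; split=> // v; have [g cg fg] := H v; split.
  by move=> x /fg; exact: isD_derivable.
by apply: class_C_ext cg => x /fg /isD_val.
Qed.

Lemma class_C_isD (f : V -> R) k v : class_C U k.+1 f ->
  class_C U k ('D_v f) /\ forall x, U x -> isD x v f ('D_v f x).
Proof.
move=> [_ /(_ v)[df Df]]; split=> // x Ux.
by apply: derivable_isD; exact: df.
Qed.

Lemma class_C_continuous (W : normedModType R) (f : V -> W) k x : class_C U k f -> U x ->
  {for x, continuous f}.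
Proof. by case: k => [|k] [cf _]; exact: cf. Qed.

Lemma class_C_cst (c : R) k : class_C U k (fun=> c).
Proof.
elim: k c => [|k IH] c; first by split=> // x _; exact: cst_continuous.
apply: class_C_derive => [x _|v]; first exact: cst_continuous.
by exists (fun=> 0) => // x _; exact: isD_cst.
Qed.

Lemma class_C_add f g k : class_C U k f -> class_C U k g ->
  class_C U k (fun x => f x + g x).
Proof.
have c f' g' x k' : class_C U k' f' -> class_C U k' g' -> U x ->
    {for x, continuous (fun x => f' x + g' x : R)}.
  move=> cf cg Ux.
  exact: continuousD (class_C_continuous cf Ux) (class_C_continuous cg Ux).
elim: k f g => [|k IH] f g cf cg; first by split=> // x; exact: c cf cg.
apply: class_C_derive => [x|v]; first exact: c cf cg.
have [Df df] := class_C_isD v cf; have [Dg dg] := class_C_isD v cg.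
exists (fun x => 'D_v f x + 'D_v g x); first exact: IH.
by move=> x Ux; apply: isD_add; [exact: df|exact: dg].
Qed.

Lemma class_C_mul f g k : class_C U k f -> class_C U k g ->
  class_C U k (fun x => f x * g x).
Proof.
have c f' g' x k' : class_C U k' f' -> class_C U k' g' -> U x ->
    {for x, continuous (fun x => f' x * g' x : R)}.
  move=> cf cg Ux.
  exact: continuousM (class_C_continuous cf Ux) (class_C_continuous cg Ux).
elim: k f g => [|k IH] f g cf cg; first by split=> // x; exact: c cf cg.
apply: class_C_derive => [x|v]; first exact: c cf cg.
have [Df df] := class_C_isD v cf; have [Dg dg] := class_C_isD v cg.
exists (fun x => f x * 'D_v g x + g x * 'D_v f x).
  by apply: class_C_add; apply: IH => //; exact: class_CS.
by move=> x Ux; apply: isD_mul; [exact: df|exact: dg].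
Qed.

Lemma class_C_inv f k : (forall x, U x -> f x != 0) -> class_C U k f ->
  class_C U k (fun x => (f x)^-1).
Proof.
move=> f0.
have c x k' : class_C U k' f -> U x -> {for x, continuous (fun x => (f x)^-1)}.
  by move=> cf Ux; apply: cvgV; [exact: f0|exact: class_C_continuous cf Ux].
elim: k => [|k IH] cf; first by split=> // x; exact: c cf.
apply: class_C_derive => [x|v]; first exact: c cf.
have [Df df] := class_C_isD v cf.
exists (fun x => - 1 * ((f x)^-1 * (f x)^-1) * 'D_v f x).
  apply: class_C_mul => //; apply: class_C_mul; first exact: class_C_cst.
  by apply: class_C_mul; apply: IH; exact: class_CS.
move=> x Ux; apply: isD_eq; first by apply: isD_inv; [exact: f0|exact: df].
by rewrite expr2 mulN1r.
Qed.

Lemma class_C_sqrt f k : (forall x, U x -> 0 < f x) -> class_C U k f ->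
  class_C U k (fun x => Num.sqrt (f x)).
Proof.
move=> f0.
have c x k' : class_C U k' f -> U x -> {for x, continuous (fun x => Num.sqrt (f x))}.
  move=> cf Ux; apply: continuous_comp (class_C_continuous cf Ux) _.
  exact: sqrt_continuous.
elim: k => [|k IH] cf; first by split=> // x; exact: c cf.
apply: class_C_derive => [x|v]; first exact: c cf.
have [Df df] := class_C_isD v cf.
exists (fun x => (2 * Num.sqrt (f x))^-1 * 'D_v f x).
  apply: class_C_mul => //; apply: class_C_inv => [x Ux|].
    by rewrite mulf_neq0 ?pnatr_eq0 // gt_eqF // sqrtr_gt0 f0.
  by apply: class_C_mul; [exact: class_C_cst|apply: IH; exact: class_CS].
by move=> x Ux; apply: isD_sqrt; [exact: f0|exact: df].
Qed.

Lemma class_C_rV n (f : V -> 'rV[R]_n) k :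
  (forall i, class_C U k (fun x => f x 0 i)) -> class_C U k f.
Proof.
have c (f' : V -> 'rV[R]_n) k' x : (forall i, class_C U k' (fun x => f' x 0 i)) ->
    U x -> {for x, continuous f'}.
  move=> cf Ux; apply/continuous_forP => e e0.
  have /filter_forall : forall i, \forall z \near x, `|f' z 0 i - f' x 0 i| < e.
    move=> i; have := class_C_continuous (cf i) Ux.
    by move=> /cvgrPdistC_lt/(_ _ e0).
  move=> /nbhs_normP[d /= d0 dP]; exists d => // z zx.
  rewrite [ltLHS]/Num.Def.normr/= mx_normrE; apply: bigmax_lt => //.
  move=> [i j] _ /=; rewrite ord1 !mxE; apply: dP.
  by rewrite /= distrC.
elim: k f => [|k IH] f cf; first by split=> // x; exact: c cf.
split=> [x|v]; first exact: c cf.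
have df x : U x -> derivable f x v.
  move=> Ux; apply/derivable_mxP => i j; rewrite ord1.
  by have [_ /(_ v)[d _]] := cf j; exact: d.
split=> //; apply: IH => i; have [_ /(_ v)[_ Df]] := cf i.
by apply: class_C_ext Df => x Ux; rewrite derive_mx ?mxE //; exact: df.
Qed.
End ClassC.

Lemma isD_coord {R : realType} n (x v : 'rV[R]_n) i :
  isD x v (fun z : 'rV[R]_n => z 0 i : R) (v 0 i).
Proof.
have d : derivable (id : 'rV[R]_n -> 'rV[R]_n) x v by exact: derivable_id.
split; first by move/derivable_mxP : d; exact.
by have := derive_mx d; rewrite derive_id => /matrixP/(_ 0 i); rewrite mxE => ->.
Qed.

Lemma class_C_coord {R : realType} n (U : set 'rV[R]_n) (i : 'I_n) k :
  open U -> class_C U k (fun x : 'rV[R]_n => x 0 i : R).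
Proof.
move=> oU; have c (x : 'rV[R]_n) : {for x, continuous (fun x : 'rV[R]_n => x 0 i : R)}.
  exact: coord_continuous.
case: k => [|k]; first by split=> // x _; exact: c.
apply: class_C_derive => // v; exists (fun=> v 0 i); first exact: class_C_cst.
move=> x _.
exact: isD_coord.
Qed.

Section Model.
Context {R : realType}.
Implicit Types (x y a v w : 'rV[R]_3).

(** Stereographic projection of the unit hyperboloid from its antipodal
    vertex, in graph coordinates, and its inverse. *)
Definition to_ball a x := (1 + hyperboloid 1 a x)^-1 *: (x + a).
Definition from_ball a y := (2 / (1 - dot y y)) *: y - a.

Lemma class_C_translated a (U : set 'rV[R]_3) k i : open U ->
  class_C U k (fun x => (x + a) 0 i).
Proof.
move=> oU; apply: (class_C_ext oU (f := fun x => x 0 i + a 0 i)).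
  by move=> x _; rewrite mxE.
by apply: class_C_add => //; [exact: class_C_coord|exact: class_C_cst].
Qed.

Lemma class_C_dot (U : set 'rV[R]_3) (f : 'rV[R]_3 -> 'rV[R]_3) k : open U ->
  (forall i, class_C U k (fun x => f x 0 i)) -> class_C U k (fun x => dot (f x) (f x)).
Proof.
move=> oU cf; apply: (class_C_ext oU (f := fun x => f x 0 ord0 * f x 0 ord0
   + f x 0 o1 * f x 0 o1 + f x 0 o2 * f x 0 o2)).
  by move=> x _; rewrite /dot sum3.
by do 2?[apply: class_C_add => //]; apply: class_C_mul.
Qed.

Lemma smooth_to_ball a : smooth setT (to_ball a).
Proof.
move=> k; have oT := @openT 'rV[R]_3.
apply: (class_C_rV oT) => i.
apply: (class_C_ext oT (f := fun x => (1 + hyperboloid 1 a x)^-1 * (x + a) 0 i)).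
  by move=> x _; rewrite [RHS]mxE.
apply: class_C_mul => //; last exact: class_C_translated.
apply: class_C_inv => //.
  by move=> x _; rewrite gt_eqF // addr_gt0 // hyperboloid_gt0.
apply: class_C_add => //; first exact: class_C_cst.
apply: class_C_sqrt => //.
  by move=> x _; rewrite ltr_pwDl ?exprn_gt0 ?dot_ge0.
apply: class_C_add => //; first exact: class_C_cst.
by apply: class_C_dot => // j; exact: class_C_translated.
Qed.

Lemma unit_ballE : unit_ball = [set y : 'rV[R]_3 | dot y y < 1].
Proof.
apply/funext => y; apply/propext; rewrite /unit_ball /= -enorm_sqr.
by rewrite -[X in _ <-> _ < X](expr1n _ 2) ltr_pXn2r ?nnegrE ?ler01 ?(enormE y) ?sqrtr_ge0.
Qed.

Lemma open_unit_ball : open (unit_ball : set 'rV[R]_3).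
Proof.
rewrite unit_ballE.
apply: (@open_comp _ _ (fun y : 'rV[R]_3 => dot y y) [set x : R | x < 1]).
  by move=> y _; exact: continuous_dot_self.
exact: open_lt.
Qed.

Lemma smooth_from_ball a : smooth unit_ball (from_ball a).
Proof.
move=> k; have oB := open_unit_ball.
apply: (class_C_rV oB) => i.
apply: (class_C_ext oB (f := fun y => 2 * (1 + - 1 * dot y y)^-1 * y 0 i + - a 0 i)).
  by move=> x _; rewrite /from_ball !mxE mulN1r.
apply: class_C_add => //; last exact: class_C_cst.
apply: class_C_mul => //; last exact: class_C_coord.
apply: class_C_mul => //; first exact: class_C_cst.
apply: class_C_inv => //.
  by move=> x; rewrite unit_ballE /= mulN1r => h; rewrite gt_eqF // subr_gt0.
apply: class_C_add => //; first exact: class_C_cst.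
apply: class_C_mul => //; first exact: class_C_cst.
by apply: class_C_dot => // j; exact: class_C_coord.
Qed.

Lemma dot_to_ball a x : dot (to_ball a x) (to_ball a x) =
  1 - 2 / (1 + hyperboloid 1 a x).
Proof.
have q0 := hyperboloid_gt0 a x (@ltr01 R).
have := hyperboloid_sqr 1 a x; rewrite expr1n => qE.
have E : dot (x + a) (x + a) = hyperboloid 1 a x ^+ 2 - 1 by rewrite qE [1 + dot _ _]addrC addrK.
rewrite /to_ball dotZl dotZr E; move: (hyperboloid 1 a x) q0 => q q0.
by field; rewrite gt_eqF // addr_gt0.
Qed.

Lemma to_ballK a x : unit_ball (to_ball a x) /\ from_ball a (to_ball a x) = x.
Proof.
have q0 := hyperboloid_gt0 a x (@ltr01 R).
have q1 : 0 < 1 + hyperboloid 1 a x by rewrite addr_gt0.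
split.
  by rewrite unit_ballE /= dot_to_ball gtrBl divr_gt0.
rewrite /from_ball dot_to_ball subKr /to_ball scalerA.
have -> : 2 / (2 / (1 + hyperboloid 1 a x)) * (1 + hyperboloid 1 a x)^-1 = 1.
  by move: (hyperboloid 1 a x) q1 => q q1; field; rewrite gt_eqF.
by rewrite scale1r addrK.
Qed.

Lemma from_ballK a y : unit_ball y -> to_ball a (from_ball a y) = y.
Proof.
rewrite unit_ballE /= => yy.
have n1 : 0 < 1 - dot y y by rewrite subr_gt0.
have n0 := dot_ge0 y.
have qE : hyperboloid 1 a (from_ball a y) = (1 + dot y y) / (1 - dot y y).
  rewrite /hyperboloid /from_ball subrK dotZl dotZr expr1n.
  have p0 : 0 <= (1 + dot y y) / (1 - dot y y).
    by apply: divr_ge0; [exact: addr_ge0|exact: ltW].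
  rewrite -[RHS](ger0_norm p0) -sqrtr_sqr; congr Num.sqrt.
  by move: (dot y y) n1 => n n1; field; rewrite gt_eqF.
rewrite /to_ball qE /from_ball subrK scalerA.
have -> : (1 + (1 + dot y y) / (1 - dot y y))^-1 * (2 / (1 - dot y y)) = 1.
  move: (dot y y) n1 n0 => n n1 n0; field.
  by rewrite gt_eqF //= (_ : 1 - n + (1 + n) = 2) ?pnatr_eq0 //; ring.
by rewrite scale1r.
Qed.

Lemma isD_hyperboloid a x v :
  isD x v (hyperboloid 1 a) (dot (x + a) v / hyperboloid 1 a x).
Proof.
have := isD_hyperboloid_line a x v 0 (@ltr01 R).
rewrite mul0r addr0 scale0r addr0 => h.
have := @is_derive_affine _ _ _ (hyperboloid 1 a) x v 0 _ h.
by rewrite scale0r addr0.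
Qed.

Lemma derive_to_ball a x v : 'D_v (to_ball a) x =
  (1 + hyperboloid 1 a x)^-1 *: v
  + - ((1 + hyperboloid 1 a x)^-1 ^+ 2 * (dot (x + a) v / hyperboloid 1 a x)) *: (x + a).
Proof.
have q0 := hyperboloid_gt0 a x (@ltr01 R).
rewrite derive_mx; last exact: smooth_derivable (@smooth_to_ball a) I.
apply/rowP => i; rewrite !mxE.
have -> : (fun z => to_ball a z 0 i) = fun z => (1 + hyperboloid 1 a z)^-1 * (z 0 i + a 0 i).
  by apply/funext => z; rewrite !mxE.
have hi : isD x v (fun z : 'rV[R]_3 => z 0 i : R) (v 0 i).
  exact: isD_coord.
apply: isD_val; apply: isD_eq.
  apply: isD_mul.
    apply: isD_inv; first by rewrite gt_eqF // addr_gt0.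
    by apply: isD_add; [exact: isD_cst|exact: isD_hyperboloid].
  by apply: isD_add; [exact: hi|exact: isD_cst].
cbv beta; rewrite add0r addr0; move: (dot _ _ / _) (_^-1) (x 0 i + a 0 i) (v 0 i).
by move=> *; ring.
Qed.

Lemma isometry_to_ball (u : 'rV[R]_3 -> R) a b : smooth setT u ->
  (forall x, u x = hyperboloid 1 a x + b) ->
  isometric setT (induced_metric u) unit_ball hyperbolic_metric.
Proof.
move=> su uE; exists (to_ball a), (from_ball a); split.
- by split; [exact: smooth_to_ball|exact: smooth_from_ball].
- by move=> x _; exact: to_ballK.
- by move=> y yB; split=> //; exact: from_ballK.
move=> x v w _.
have du v' : \sum_i v' 0 i * partial i u x = dot (x + a) v' / hyperboloid 1 a x.
  rewrite -(derive_dirE su); have -> : u = fun x => hyperboloid 1 a x + b by apply/funext.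
  apply: isD_val; apply: isD_eq.
    by apply: isD_add; [exact: isD_hyperboloid|exact: isD_cst].
  by rewrite addr0.
rewrite (induced_metric_at su). rewrite !du -/(dot v w).
have -> (G : R) v' w' : metric_at (G%:M) v' w' = G * dot v' w'.
  rewrite /metric_at mul_mx_scalar -scalemxAl mxE; congr (_ * _).
  by rewrite mxE; apply: eq_bigr => i _; rewrite mxE.
rewrite enorm_sqr dot_to_ball subKr !derive_to_ball.
have q0 := hyperboloid_gt0 a x (@ltr01 R).
have := hyperboloid_sqr 1 a x; rewrite expr1n => qE.
have E : dot (x + a) (x + a) = hyperboloid 1 a x ^+ 2 - 1.
  by rewrite qE [1 + dot _ _]addrC addrK.
move: (x + a) (hyperboloid 1 a x) E q0 => X q E q0.
rewrite !dotDl !dotDr !dotZl !dotZr (dotC v X) E.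
move: (dot X v) (dot X w) (dot v w) => p r s; field.
by rewrite !gt_eqF // addr_gt0.
Qed.
End Model.

Theorem theorem3p3 (R : realType) (u : 'rV[R]_3 -> R)
  (hsmooth : smooth setT u)
  (hspacelike : spacelike u)
  (hcomplete : complete_metric (induced_metric u))
  (hcmc : forall x : 'rV[R]_3, mean_curvature u x = 1)
  (hP : smooth_up_to_infinity (P u))
  (hS : bigO_s (fun x => `|scalar_curvature (induced_metric u) x + 6|) 4) :
  (exists (a : 'rV[R]_3) (b : R),
     forall x : 'rV[R]_3, u x = Num.sqrt (1 + enorm (x + a) ^+ 2) + b) /\
  isometric setT (induced_metric u) unit_ball hyperbolic_metric.
Proof.
have [a [b uE]] := u_hyperboloid hsmooth hspacelike hcmc
  (asymptotic_affine hsmooth hspacelike hcmc hS hP).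
split; last exact: isometry_to_ball hsmooth uE.
by exists a, b => x; rewrite uE /hyperboloid expr1n enorm_sqr.
Qed.
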